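(* Let $n \in \mathbb{N}$ and let $\{A_i\}_{i \in \mathcal{I}}$ be a finite collection of contracting, non-singular real $n \times n$ matrices which are simultaneously triangularisable. Then the pressure $P : [0,\infty) \to \mathbb{R}$ of $\{A_i\}_{i \in \mathcal{I}}$ is piecewise real analytic.
   Context: The index set $\mathcal{I}$ is finite and non-empty, and $\mathcal{I}^* = \bigcup_{k \geq 1} \mathcal{I}^k$ is the set of all finite words over $\mathcal{I}$. For $\mathbf{i} = (i_1,\dots,i_k) \in \mathcal{I}^*$ write $A_{\mathbf{i}} = A_{i_1} A_{i_2} \cdots A_{i_k}$, and let $\alpha_1(\mathbf{i}) \geq \dots \geq \alpha_n(\mathbf{i}) > 0$ be the singular values of $A_{\mathbf{i}}$ (the positive square roots of the eigenvalues of $A_{\mathbf{i}}^T A_{\mathbf{i}}$, with multiplicity). A matrix is contracting if it is a contraction of $\mathbb{R}^n$ with the Euclidean norm, i.e. its largest singular value is strictly less than $1$. The matrices are simultaneously triangularisable if there is a basis of $\mathbb{R}^n$ with respect to which all of them are upper triangular, or all of them are lower triangular. For $s \in [0,n)$, the singular value function is $$\phi^s(\mathbf{i}) = \alpha_1(\mathbf{i}) \cdots \alpha_m(\mathbf{i})\, \alpha_{m+1}(\mathbf{i})^{s-m},$$ where $m \in \{0,\dots,n-1\}$ is the unique integer with $m \leq s < m+1$. The pressure $P:[0,\infty) \to \mathbb{R}$ of $\{A_i\}_{i\in\mathcal{I}}$ is $$P(s) = \lim_{k \to \infty} \frac{1}{k} \log \sum_{\mathbf{i} \in \mathcal{I}^k}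 \phi^s(\mathbf{i}) \quad (0 \leq s < n), \qquad P(s) = \log \sum_{i \in \mathcal{I}} |\det A_i|^{s/n} \quad (s \geq n).$$ The limit exists because $\phi^s$ is submultiplicative: $\phi^s(\mathbf{i}\,\mathbf{j}) \leq \phi^s(\mathbf{i})\phi^s(\mathbf{j})$. A real valued function on a domain $D \subseteq \mathbb{R}$ is piecewise real analytic if $D$ can be written as the closure of the union of a finite collection of open (possibly unbounded) intervals such that the function is real analytic on each of these intervals. *)

(* Defs.v *)
From mathcomp Require Import all_boot all_order all_algebra.
From mathcomp Require Import all_classical all_reals all_analysis.
From mathcomp.real_closed Require Import polyrcf.
Set Implicit Arguments.
Unset Strict Implicit.
Unset Printing Implicit Defensive.
Import Order.TTheory GRing.Theory Num.Theory numFieldNormedType.Exports.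
Local Open Scope classical_set_scope.
Local Open Scope ring_scope.

(* [rootsR] lists each real root once; [mup] restores the multiplicities.
   Nothing is lost by looking at real roots only: A^T A is symmetric, hence
   has n real eigenvalues, all of them nonnegative. *)
Definition singular_values (R : rcfType) (n : nat) (A : 'M[R]_n) : seq R :=
  let p := char_poly (A^T *m A) in
  sort >=%R
    [seq Num.sqrt l | l <- flatten [seq nseq (mup l p) l | l <- rootsR p]].

(* Numbered from 0: [singular_value A j] is alpha_(j+1). *)
Definition singular_value (R : rcfType) (n : nat) (A : 'M[R]_n) (j : nat) : R :=
  (singular_values A)`_j.

Definition contracting (R : rcfType) (n : nat) (A : 'M[R]_n) : Prop :=
  singular_value A 0 < 1.

(* The columns of P form the basis. [is_trig_mx] means lower triangular. *)
Definition simultaneously_triangularisable (F : fieldType) (n : nat)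
    (I : Type) (A : I -> 'M[F]_n) : Prop :=
  exists2 P : 'M[F]_n, P \in unitmx &
    (forall i, is_trig_mx (invmx P *m A i *m P)^T) \/
    (forall i, is_trig_mx (invmx P *m A i *m P)).

Definition word_mx (R : pzRingType) (n : nat) (I : Type) (A : I -> 'M[R]_n)
    (w : seq I) : 'M[R]_n :=
  \big[mulmx/1%:M]_(i <- w) A i.

(* Meaningful for 0 <= s < n. *)
Definition sv_function (R : realType) (n : nat) (s : R) (A : 'M[R]_n) : R :=
  let m := Num.truncn s in
  (\prod_(j < m) singular_value A j) * singular_value A m `^ (s - m%:R).

(* Meaningful for 0 <= s. *)
Definition pressure (R : realType) (n : nat) (I : finType) (A : I -> 'M[R]_n)
    (s : R) : R :=
  if s < n%:R then
    lim ((fun k : nat =>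
      k%:R^-1 * ln (\sum_(w : k.-tuple I) sv_function s (word_mx A w))) @ \oo)
  else ln (\sum_(i : I) `|\det (A i)| `^ (s / n%:R)).

Definition real_analytic_at (R : realType) (f : R -> R) (x : R) : Prop :=
  exists a : nat -> R, \forall y \near x, pseries a (y - x) @ \oo --> f y.

(* Each [J k] is an open, possibly unbounded interval. *)
Definition piecewise_real_analytic (R : realType) (D : set R) (f : R -> R) :
    Prop :=
  exists (N : nat) (J : 'I_N -> set R),
    [/\ forall k, open (J k) /\ is_interval (J k),
        D = closure (\bigcup_k J k) &
        forall k x, J k x -> real_analytic_at f x].

(* Main.v *)
Require Import Defs.
From mathcomp Require Import all_boot all_order all_algebra all_fingroup.
From mathcomp Require Import all_classical all_reals all_analysis.
From mathcomp Require Import finmap ring lra.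
From mathcomp.real_closed Require Import polyrcf complex.
Import Order.TTheory GRing.Theory Num.Theory numFieldNormedType.Exports.
Local Open Scope classical_set_scope.
Local Open Scope ring_scope.
Set Implicit Arguments.
Unset Strict Implicit.
Unset Printing Implicit Defensive.

(** For [m < s < m + 1 <= n] the singular value function is
    [(alpha_1 ... alpha_m)^(m+1-s) (alpha_1 ... alpha_(m+1))^(s-m)], and up to
    constant factors [alpha_1 ... alpha_k] is the sum [minor_norm k] of the
    absolute values of the [k]-minors: the [k]-th elementary symmetric function
    of the eigenvalues of [A^T A] is both comparable to its largest term
    [(alpha_1 ... alpha_k)^2] and, by Cauchy-Binet, a sum of squares of minors
    of [A] ([top_product_le_minor_norm], [minor_norm_le_top_product]). The
    quantity [minor_norm k] is submultiplicative, so a change of basis costs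
    only a constant and the matrices may be replaced by triangular ones.

    For triangular matrices the growth of the minors along words is explicit.
    Expanding a minor of a product along injective index maps gives a linear
    recursion that is itself triangular, for the partial order in which the sum
    of the ranks of the indices increases; its diagonal coefficients are
    products of diagonal entries of the matrices. A nonnegative triangular
    recursion grows no faster than its largest diagonal coefficient
    ([triangular_recursion_bound]), and the diagonal minors show that it does
    grow that fast ([word_sum_ge]). Hence ([pressure_eq_max]), on [(m, m+1)],
    [P s] is the logarithm of the largest of the finitely many functions
    [sum_i a_i^(m+1-s) b_i^(s-m)], where [a_i] and [b_i] are absolute values of
    products of [m] and of [m+1] diagonal entries of the [i]-th triangular
    matrix.

    These functions, like the one giving the pressure to the right of [n], are
    sums of exponentials in [s]. By Rolle's theorem two such sums either agree
    identically or meet at finitely many points ([exp_sum_zeros]). Away from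
    these points and from the integers up to [n], the pressure is locally the
    logarithm of a single positive exponential sum, which is analytic
    ([real_analytic_at_ln]); a finite exceptional set is exactly what piecewise
    analyticity allows ([piecewise_of_finite_exceptions]). *)

(** * Minors and the Cauchy-Binet formula *)
Section Minors.
Variables (R : comNzRingType).

(** The sum runs over all maps [h], not only over the increasing ones as in
    the usual Cauchy-Binet formula: multilinearity in the rows of [X *m Y]
    produces exactly these terms, and the ones with [h] not injective vanish.
    Indexing minors by maps rather than by subsets avoids every choice of an
    ordering. *)
Lemma det_mulmx_expand (m n : nat) (X : 'M[R]_(m, n)) (Y : 'M[R]_(n, m)) :
  \det (X *m Y) =
  \sum_(h : {ffun 'I_m -> 'I_n}) (\prod_i X i (h i)) * \det (rowsub h Y).
Proof.
rewrite /determinant.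
transitivity (\sum_(s : 'S_m) \sum_(h : {ffun 'I_m -> 'I_n})
   (\prod_i X i (h i)) * ((-1) ^+ s * \prod_i Y (h i) (s i))).
  apply: eq_bigr => s _.
  transitivity ((-1) ^+ s * \prod_i \sum_j (X i j * Y j (s i))).
    by congr (_ * _); apply: eq_bigr => i _; rewrite mxE.
  rewrite bigA_distr_bigA /= big_distrr /=; apply: eq_bigr => h _.
  by rewrite big_split /= mulrCA.
rewrite exchange_big /=; apply: eq_bigr => h _; rewrite big_distrr /=.
apply: eq_bigr => s _; do 2!congr (_ * _).
by apply: eq_bigr => i _; rewrite mxE.
Qed.

Lemma det_rowsub_perm (m n : nat) (h : 'I_m -> 'I_n) (s : 'S_m)
    (Y : 'M[R]_(n, m)) :
  \det (rowsub (h \o s) Y) = (-1) ^+ s * \det (rowsub h Y).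
Proof.
rewrite -det_perm -det_mulmx -row_permE; congr (\det _).
by apply/matrixP => i j; rewrite !mxE.
Qed.

(** Each [m]-subset of columns is the image of [m!] maps [h], which all give
    the same product of minors; this is the factor on the left. The formula is
    obtained by averaging [det_mulmx_expand] over the permutations of the
    factors of [\prod_i X i (h i)]. *)
Lemma cauchy_binet (m n : nat) (X : 'M[R]_(m, n)) (Y : 'M[R]_(n, m)) :
  (m`!)%:R * \det (X *m Y) =
  \sum_(h : {ffun 'I_m -> 'I_n}) \det (colsub h X) * \det (rowsub h Y).
Proof.
have E (s : 'S_m) : \det (X *m Y) = \sum_(h : {ffun 'I_m -> 'I_n})
    ((-1) ^+ s * \prod_i X i (h (s i))) * \det (rowsub h Y).
  rewrite det_mulmx_expand.
  have bij_s : bijective (fun h : {ffun 'I_m -> 'I_n} => [ffun i => h (s i)]).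
    exists (fun h : {ffun 'I_m -> 'I_n} => [ffun i => h ((s^-1)%g i)]) => h;
    by apply/ffunP => i; rewrite !ffunE ?permK ?permKV.
  rewrite (reindex _ (onW_bij _ bij_s)) /=.
  apply: eq_bigr => h _; rewrite [(-1) ^+ _ * _]mulrC -mulrA -det_rowsub_perm.
  congr (_ * _); first by apply: eq_bigr => i _; rewrite ffunE.
  by congr (\det _); apply/matrixP => i j; rewrite !mxE ffunE.
transitivity (\sum_(s : 'S_m) \det (X *m Y)).
  by rewrite sumr_const card_Sn mulr_natl.
under eq_bigr => s _ do rewrite (E s).
rewrite exchange_big /=; apply: eq_bigr => h _; rewrite -big_distrl /=.
congr (_ * _); rewrite /determinant; apply: eq_bigr => s _; congr (_ * _).
by apply: eq_bigr => i _; rewrite mxE.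
Qed.

Lemma mxsub_mul (m n : nat) (f g : 'I_m -> 'I_n) (A B : 'M[R]_n) :
  mxsub f g (A *m B) = rowsub f A *m colsub g B.
Proof.
by apply/matrixP => i j; rewrite !mxE; apply: eq_bigr => k _; rewrite !mxE.
Qed.

Lemma minor_mul_expand (m n : nat) (f g : 'I_m -> 'I_n) (A B : 'M[R]_n) :
  \det (mxsub f g (A *m B)) = \sum_(h : {ffun 'I_m -> 'I_n})
    (\prod_i A (f i) (h i)) * \det (mxsub h g B).
Proof.
rewrite mxsub_mul det_mulmx_expand; apply: eq_bigr => h _; congr (_ * _).
  by apply: eq_bigr => i _; rewrite mxE.
by congr (\det _); apply/matrixP => i j; rewrite !mxE.
Qed.

Lemma minor_mul (m n : nat) (f g : 'I_m -> 'I_n) (A B : 'M[R]_n) :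
  (m`!)%:R * \det (mxsub f g (A *m B)) = \sum_(h : {ffun 'I_m -> 'I_n})
    \det (mxsub f h A) * \det (mxsub h g B).
Proof.
rewrite mxsub_mul cauchy_binet; apply: eq_bigr => h _.
by congr (_ * _); congr (\det _); apply/matrixP => i j; rewrite !mxE.
Qed.

Lemma minor_noninj (m n : nat) (f g : 'I_m -> 'I_n) (A : 'M[R]_n) :
  ~~ injectiveb f -> \det (mxsub f g A) = 0.
Proof.
case/injectivePn => i [j neq_ij eq_f].
by apply: (determinant_alternate neq_ij) => k; rewrite !mxE eq_f.
Qed.

(** This is [m!] times the sum of the principal [m]-minors, that is, [m!]
    times the [m]-th elementary symmetric function of the eigenvalues. *)
Definition minor_sum (m n : nat) (M : 'M[R]_n) : R :=
  \sum_(f : {ffun 'I_m -> 'I_n}) \det (mxsub f f M).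

Lemma minor_sum_mul (m n : nat) (A B : 'M[R]_n) :
  (m`!)%:R * minor_sum m (A *m B) =
  \sum_(f : {ffun 'I_m -> 'I_n}) \sum_(h : {ffun 'I_m -> 'I_n})
    \det (mxsub f h A) * \det (mxsub h f B).
Proof.
by rewrite /minor_sum big_distrr /=; apply: eq_bigr => f _; rewrite minor_mul.
Qed.

(** The analogue of [\tr (A *m B) = \tr (B *m A)]; it makes [minor_sum]
    invariant under a change of basis. *)
Lemma minor_sumC (m n : nat) (A B : 'M[R]_n) :
  (m`!)%:R * minor_sum m (A *m B) = (m`!)%:R * minor_sum m (B *m A).
Proof.
rewrite !minor_sum_mul exchange_big /=.
by apply: eq_bigr => f _; apply: eq_bigr => g _; rewrite mulrC.
Qed.

Lemma det_diag_minor (m n : nat) (d : 'rV[R]_n) (f : {ffun 'I_m -> 'I_n}) :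
  injectiveb f -> \det (mxsub f f (diag_mx d)) = \prod_i d 0 (f i).
Proof.
move=> /injectiveP f_inj.
rewrite (_ : mxsub _ _ _ = diag_mx (\row_i d 0 (f i))).
  by rewrite det_diag; apply: eq_bigr => i _; rewrite mxE.
by apply/matrixP => i j; rewrite !mxE (inj_eq f_inj).
Qed.

Lemma minor_sum_diag (m n : nat) (d : 'rV[R]_n) :
  minor_sum m (diag_mx d) =
  \sum_(f : {ffun 'I_m -> 'I_n} | injectiveb f) \prod_i d 0 (f i).
Proof.
rewrite /minor_sum (bigID (fun f : {ffun 'I_m -> 'I_n} => injectiveb f)) /=.
rewrite [X in _ + X]big1 ?addr0 => [|f /minor_noninj-> //].
by apply: eq_bigr => f /det_diag_minor ->.
Qed.

End Minors.

(** * The spectrum of a symmetric matrix *)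
Section Spectral.
Variable R : rcfType.
Local Notation toC := (real_complex R).

Lemma char_poly_conj (F : fieldType) (n : nat) (P D : 'M[F]_n) :
  P \in unitmx -> char_poly (invmx P *m D *m P) = char_poly D.
Proof.
move=> uP; rewrite /char_poly.
have -> : char_poly_mx (invmx P *m D *m P) =
    map_mx polyC (invmx P) *m char_poly_mx D *m map_mx polyC P.
  rewrite /char_poly_mx !map_mxM mulmxBr mulmxBl; congr (_ - _).
  by rewrite scalar_mxC -mulmxA -map_mxM mulVmx // map_mx1 mulmx1.
rewrite !det_mulmx mulrC mulrA -det_mulmx -map_mxM mulmxV //.
by rewrite map_mx1 det1 mul1r.
Qed.

Lemma minor_sum_conj (F : numFieldType) (m n : nat) (P D : 'M[F]_n) :
  P \in unitmx -> minor_sum m (invmx P *m D *m P) = minor_sum m D.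
Proof.
move=> uP; apply: (@mulfI _ (m`!)%:R).
  by rewrite pnatr_eq0 -lt0n fact_gt0.
by rewrite -mulmxA minor_sumC -mulmxA mulmxV // mulmx1.
Qed.

(** The spectral theorem over the complex numbers diagonalises [M] with real
    eigenvalues [l]. The eigenvectors are complex, but both conclusions are
    identities between real quantities invariant under conjugation, so they
    descend to [R]. *)
Lemma sym_spectrum (n : nat) (M : 'M[R]_n) : M^T = M ->
  exists l : 'I_n -> R, char_poly M = \prod_i ('X - (l i)%:P) /\
    forall m, minor_sum m M =
      \sum_(f : {ffun 'I_m -> 'I_n} | injectiveb f) \prod_i l (f i).
Proof.
move=> symM; pose MC := map_mx toC M.
have herm : MC \is hermsymmx.
  apply: realsym_hermsym.
    apply/is_hermitianmxP; rewrite expr0 scale1r map_mx_id //.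
    by rewrite map_trmx symM.
  apply/mxOverP => i j; by rewrite mxE complex_real.
have := hermitian_normalmx herm => /orthomx_spectralP.
set P := spectralmx _; set d := spectral_diag _ => MCE.
have uP : P \in unitmx by exact: spectral_unit.
have dreal i : d 0 i \is Num.real.
  by have /mxOverP := hermitian_spectral_diag_real herm; apply.
have dE i : d 0 i = toC (complex.Re (d 0 i)).
  by rewrite RRe_real.
exists (fun i => complex.Re (d 0 i)); split.
  apply: (@map_poly_inj _ _ toC); rewrite map_char_poly -/MC MCE char_poly_conj //.
  rewrite char_poly_trig ?diag_mx_is_trig // rmorph_prod /=.
  apply: eq_bigr => i _; rewrite rmorphB /= map_polyX map_polyC /= -dE.
  by rewrite mxE eqxx mulr1n.
move=> m; apply: (@fmorph_inj _ _ toC).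
transitivity (minor_sum m MC).
  rewrite rmorph_sum; apply: eq_bigr => f _.
  by rewrite /= -det_map_mx; congr (\det _); apply/matrixP => i j; rewrite !mxE.
rewrite MCE minor_sum_conj // minor_sum_diag rmorph_sum /=.
apply: eq_bigr => f _; rewrite rmorph_prod; apply: eq_bigr => i _; exact: dE.
Qed.

End Spectral.

(** * Products of singular values and minors *)
Section SingularValues.
Variable R : rcfType.

(** If [v *m (A^T *m A) = x *: v] then [v *m A^T] has squared length [x] times
    that of [v]. *)
Lemma gram_eigenvalue_gt0 (n : nat) (A : 'M[R]_n) (x : R) :
  A \in unitmx -> root (char_poly (A^T *m A)) x -> 0 < x.
Proof.
move=> uA; rewrite -eigenvalue_root_char => /eigenvalueP[v vM v0].
pose u := v *m A^T.
have sqE (w : 'rV[R]_n) : (w *m w^T) 0 0 = \sum_j w 0 j ^+ 2.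
  by rewrite mxE; apply: eq_bigr => j _; rewrite mxE expr2.
have sq_gt0 (w : 'rV[R]_n) : w != 0 -> 0 < (w *m w^T) 0 0.
  move=> w0; rewrite lt_def sqE sumr_ge0 ?andbT => [|j _]; last exact: sqr_ge0.
  apply: contraNneq w0 => /eqP; rewrite psumr_eq0 => [/allP w0|j _]; last first.
    exact: sqr_ge0.
  apply/eqP/rowP => j; rewrite mxE; apply/eqP.
  by have := w0 j (mem_index_enum j); rewrite /= sqrf_eq0.
have uu : u *m u^T = x *: (v *m v^T).
  by rewrite /u trmx_mul trmxK !mulmxA -(mulmxA v) vM scalemxAl.
have u0 : u != 0.
  apply: contraNneq v0 => u0.
  have : u *m invmx A^T = 0 by rewrite u0 mul0mx.
  by rewrite /u mulmxK ?unitmx_tr // => ->.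
have := sq_gt0 _ u0; rewrite uu mxE.
by rewrite pmulr_lgt0 ?sq_gt0.
Qed.

(** Since the characteristic polynomial of [A^T *m A] splits over [R], its
    distinct roots repeated with their multiplicities are the whole spectrum,
    so that sums over the spectrum become sums over the singular values. *)
Lemma singular_valuesP (n : nat) (A : 'M[R]_n) : A \in unitmx ->
  [/\ size (singular_values A) = n,
      sorted >=%R (singular_values A),
      (forall j, (j < n)%N -> 0 < singular_value A j) &
      forall m, minor_sum m (A^T *m A) =
        \sum_(f : {ffun 'I_m -> 'I_n} | injectiveb f)
          \prod_i singular_value A (f i) ^+ 2].
Proof.
move=> uA.
have [l [pE sumE]] : exists l : 'I_n -> R,
    char_poly (A^T *m A) = \prod_i ('X - (l i)%:P) /\
    forall m, minor_sum m (A^T *m A) =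
      \sum_(f : {ffun 'I_m -> 'I_n} | injectiveb f) \prod_i l (f i).
  by apply: sym_spectrum; rewrite trmx_mul trmxK.
pose p := char_poly (A^T *m A).
have p0 : p != 0 by rewrite monic_neq0 // char_poly_monic.
pose ls := [seq l i | i <- enum 'I_n].
have pEls : p = \prod_(x <- ls) ('X - x%:P).
  by rewrite /p pE big_map big_enum.
have l_gt0 i : 0 < l i.
  apply: (gram_eigenvalue_gt0 uA); rewrite -/p pEls root_prod_XsubC.
  by apply: map_f; rewrite mem_enum.
have perm_ls : perm_eq
    (flatten [seq nseq (mup x p) x | x <- rootsR p]) ls.
  have -> : [seq nseq (mup x p) x | x <- rootsR p] =
            [seq nseq (count_mem x ls) x | x <- rootsR p].
    by apply: eq_map => x; rewrite pEls mu_prod_XsubC.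
  apply: perm_trans (perm_count_undup ls).
  apply/perm_flatten/perm_map/uniq_perm; rewrite ?undup_uniq //.
    exact: uniq_roots.
  move=> x; rewrite mem_undup -(root_prod_XsubC ls) -pEls.
  by rewrite -(roots_on_rootsR p0) in_itv.
pose t := [tuple Num.sqrt (l i) | i < n].
have perm_t : perm_eq (singular_values A) t.
  rewrite perm_sort (_ : tval t = [seq Num.sqrt x | x <- ls]) ?perm_map //.
  by rewrite /= /ls -map_comp.
have [s sE] := tuple_permP perm_t.
have szE : size (singular_values A) = n by rewrite sE size_tuple.
have svE (j : 'I_n) : singular_value A j = Num.sqrt (l (s j)).
  by rewrite /singular_value sE -tnth_nth !tnth_mktuple.
split=> //.
- by apply: sort_sorted => x y; rewrite le_total.
- by move=> j jn; rewrite (svE (Ordinal jn)) sqrtr_gt0.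
move=> m; rewrite sumE.
have bij_s : bijective (fun h : {ffun 'I_m -> 'I_n} => [ffun i => s (h i)]).
  exists (fun h : {ffun 'I_m -> 'I_n} => [ffun i => (s^-1)%g (h i)]) => h;
  by apply/ffunP => i; rewrite !ffunE ?permK ?permKV.
rewrite (reindex _ (onW_bij _ bij_s)) /=; apply: eq_big => h.
  apply/injectiveP/injectiveP => h_inj i j; last by rewrite !ffunE => /perm_inj/h_inj.
  by move=> hij; apply: h_inj; rewrite !ffunE hij.
by move=> _; apply: eq_bigr => i _; rewrite ffunE svE sqr_sqrtr ?ltW.
Qed.

Lemma singular_value_le (n : nat) (A : 'M[R]_n) (i j : nat) : A \in unitmx ->
  (i <= j)%N -> (j < n)%N -> singular_value A j <= singular_value A i.
Proof.
move=> uA ij jn; have [szE srt _ _] := singular_valuesP uA.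
rewrite /singular_value.
apply: (sorted_leq_nth (leT := >=%R) _ _ 0 srt) => //.
- by move=> y x z; rewrite /= => yx zy; apply: le_trans zy yx.
- by move=> x; apply: lexx.
- by rewrite inE szE (leq_ltn_trans ij).
by rewrite inE szE.
Qed.

(** The largest element of [S] is at least [#|S| - 1], so its factor is at most
    the last factor on the right; remove it and induct. *)
Lemma prod_nonincreasing_le (n : nat) (a : nat -> R) (S : {set 'I_n}) :
  (forall i, (i < n)%N -> 0 <= a i) ->
  (forall i j, (i <= j)%N -> (j < n)%N -> a j <= a i) ->
  \prod_(i in S) a i <= \prod_(j < #|S|) a j.
Proof.
move=> a0 amono; have [k] := ubnP #|S|; elim: k S => // k IH S ltSk.
have [->|/set0Pn[i0 i0S]] := eqVneq S finset.set0.
  by rewrite big_set0 cards0 big_ord0.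
pose i := [arg max_(i > i0 in S) (i : nat)].
have [iS imax] : i \in S /\ forall j, j \in S -> (j <= i)%N.
  by rewrite /i; case: arg_maxnP => // j jS jm; split.
rewrite (big_setD1 i iS) /= (cardsD1 i S) iS add1n big_ord_recr /= mulrC.
have cardle : (#|S :\ i| <= i)%N.
  rewrite cardE -(size_map val) -(size_iota 0 i); apply: uniq_leq_size.
    by rewrite (map_inj_uniq val_inj) enum_uniq.
  move=> _ /mapP[j + ->]; rewrite mem_enum !inE mem_iota /= => /andP[ji /imax].
  rewrite leq_eqVlt => /orP[/eqP/val_inj/eqP|//].
  by rewrite (negPf ji).
apply: ler_pM => //.
- by apply: prodr_ge0 => j _; apply: a0.
- exact: a0.
- by apply: IH; rewrite -ltnS (leq_trans _ ltSk) // [in X in (_ < X)%N](cardsD1 i S) iS.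
exact: amono.
Qed.

Lemma prod_inj_nonincreasing_le (n m : nat) (a : nat -> R) (f : 'I_m -> 'I_n) :
  (forall i, (i < n)%N -> 0 <= a i) ->
  (forall i j, (i <= j)%N -> (j < n)%N -> a j <= a i) ->
  injective f -> \prod_i a (f i) <= \prod_(j < m) a j.
Proof.
move=> a0 amono f_inj.
have := prod_nonincreasing_le (f @: [set: 'I_m])%SET a0 amono.
rewrite big_imset /=; last by move=> x y _ _; apply: f_inj.
rewrite card_imset // cardsT card_ord.
by under eq_bigl do rewrite inE.
Qed.

Definition top_product (n m : nat) (A : 'M[R]_n) : R :=
  \prod_(j < m) singular_value A j.

Definition minor_norm (n m : nat) (A : 'M[R]_n) : R :=
  \sum_(f : {ffun 'I_m -> 'I_n}) \sum_(g : {ffun 'I_m -> 'I_n})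
    `|\det (mxsub f g A)|.

Lemma minor_norm_ge0 (n m : nat) (A : 'M[R]_n) : 0 <= minor_norm m A.
Proof. by apply: sumr_ge0 => f _; apply: sumr_ge0. Qed.

Lemma top_product_gt0 (n m : nat) (A : 'M[R]_n) : A \in unitmx -> (m <= n)%N ->
  0 < top_product m A.
Proof.
move=> uA mn; have [_ _ pos _] := singular_valuesP uA.
by apply: prodr_gt0 => j _; apply: pos; apply: leq_trans mn.
Qed.

(** Cauchy-Binet for [A^T *m A]: the minors of [A^T] are those of [A]. *)
Lemma minor_sum_gram (n m : nat) (A : 'M[R]_n) :
  (m`!)%:R * minor_sum m (A^T *m A) =
  \sum_(f : {ffun 'I_m -> 'I_n}) \sum_(g : {ffun 'I_m -> 'I_n})
    \det (mxsub f g A) ^+ 2.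
Proof.
rewrite minor_sum_mul exchange_big /=; apply: eq_bigr => f _.
apply: eq_bigr => g _; rewrite expr2; congr (_ * _).
by rewrite -det_tr; congr (\det _); apply/matrixP => i j; rewrite !mxE.
Qed.

(** In the sum over injective [f] of [\prod_i alpha_(f i)^2] the largest term
    is the one where [f] is the inclusion, and the number of terms depends only
    on [n] and [m]. *)
Lemma minor_sum_gram_bounds (n m : nat) (A : 'M[R]_n) : A \in unitmx ->
  (m <= n)%N ->
  top_product m A ^+ 2 <= minor_sum m (A^T *m A) <=
  #|{ffun 'I_m -> 'I_n}|%:R * top_product m A ^+ 2.
Proof.
move=> uA mn; have [_ _ pos ->] := singular_valuesP uA.
apply/andP; split.
  pose f0 : {ffun 'I_m -> 'I_n} := [ffun i => widen_ord mn i].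
  have f0_inj : injectiveb f0.
    by apply/injectiveP => i j; rewrite !ffunE => /(congr1 val) /= /val_inj.
  have <- : \prod_i singular_value A (f0 i) ^+ 2 = top_product m A ^+ 2.
    by rewrite /top_product -prodrXl; apply: eq_bigr => i _; rewrite ffunE.
  rewrite (bigD1 f0) //= lerDl.
  apply: sumr_ge0 => f _; apply: prodr_ge0 => i _; exact: sqr_ge0.
rewrite mulr_natl -sumr_const big_mkcond /=; apply: ler_sum => f _.
case: ifP => [/injectiveP f_inj|_]; last exact: sqr_ge0.
rewrite prodrXl lerXn2r ?nnegrE ?prodr_ge0 //.
- by move=> i _; rewrite ltW // pos.
- by move=> i _; rewrite ltW // pos // (leq_trans _ mn).
apply: (prod_inj_nonincreasing_le (a := singular_value A)) => //.
  by move=> i ni; rewrite ltW // pos.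
by move=> i j; apply: singular_value_le.
Qed.

(** A sum of squares is at most the square of the sum of the absolute values. *)
Lemma top_product_le_minor_norm (n m : nat) (A : 'M[R]_n) : A \in unitmx ->
  (m <= n)%N -> top_product m A <= minor_norm m A.
Proof.
move=> uA mn; have p0 := ltW (top_product_gt0 uA mn).
rewrite -(@ler_pXn2r _ 2) ?nnegrE ?minor_norm_ge0 //.
have /andP[le1 _] := minor_sum_gram_bounds uA mn.
apply: le_trans le1 _.
apply: (@le_trans _ _ ((m`!)%:R * minor_sum m (A^T *m A))).
  rewrite ler_peMl ?ler1n ?fact_gt0 //.
  have /andP[+ _] := minor_sum_gram_bounds uA mn; apply: le_trans; exact: sqr_ge0.
rewrite minor_sum_gram /minor_norm.
rewrite !pair_big /= expr2 big_distrl /=; apply: ler_sum => -[f g] _ /=.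
rewrite -real_normK ?num_real // expr2 ler_wpM2l //.
by rewrite (bigD1 (f, g)) //= lerDl sumr_ge0.
Qed.

Lemma minor_norm_le_top_product (n m : nat) : (m <= n)%N ->
  exists2 C : R, 0 < C & forall A : 'M[R]_n, A \in unitmx ->
    minor_norm m A <= C * top_product m A.
Proof.
move=> mn; pose N := #|{ffun 'I_m -> 'I_n}|%:R : R.
have N_ge1 : 1 <= N.
  by rewrite ler1n; apply/card_gt0P; exists [ffun i => widen_ord mn i].
pose K := (m`!)%:R * N.
have K_ge1 : 1 <= K by rewrite mulr_ege1 // ler1n fact_gt0.
have K_ge0 : 0 <= K := le_trans ler01 K_ge1.
exists (N * N * K) => [|A uA]; first by rewrite !mulr_gt0 // (lt_le_trans ltr01).
have p0 := ltW (top_product_gt0 uA mn).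
have /andP[_ le2] := minor_sum_gram_bounds uA mn.
have minor_le (f g : {ffun 'I_m -> 'I_n}) :
    `|\det (mxsub f g A)| <= K * top_product m A.
  rewrite -(@ler_pXn2r _ 2) ?nnegrE ?mulr_ge0 //.
  rewrite real_normK ?num_real //.
  apply: (@le_trans _ _ ((m`!)%:R * minor_sum m (A^T *m A))).
    rewrite minor_sum_gram (bigD1 f) //= (bigD1 g) //= -addrA lerDl addr_ge0 //.
      by apply: sumr_ge0 => h _; apply: sqr_ge0.
    by apply: sumr_ge0 => h _; apply: sumr_ge0 => h' _; apply: sqr_ge0.
  apply: le_trans (ler_wpM2l (ler0n _ _) le2) _.
  rewrite mulrA exprMn ler_wpM2r ?sqr_ge0 // -/N -/K.
  by rewrite expr2 ler_peMr.
apply: (@le_trans _ _ (\sum_(f : {ffun 'I_m -> 'I_n})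
    \sum_(g : {ffun 'I_m -> 'I_n}) K * top_product m A)).
  by apply: ler_sum => f _; apply: ler_sum => g _.
by rewrite !sumr_const -mulrnA -[leLHS]mulr_natl natrM -/N !mulrA.
Qed.

(** Immediate from [minor_mul]: its factor [m!] is at least [1]. *)
Lemma minor_norm_mul (n m : nat) (A B : 'M[R]_n) :
  minor_norm m (A *m B) <= minor_norm m A * minor_norm m B.
Proof.
rewrite /minor_norm.
apply: (@le_trans _ _ (\sum_(f : {ffun 'I_m -> 'I_n}) \sum_(g : {ffun 'I_m -> 'I_n})
   \sum_(h : {ffun 'I_m -> 'I_n}) `|\det (mxsub f h A)| * `|\det (mxsub h g B)|)).
  apply: ler_sum => f _; apply: ler_sum => g _.
  apply: (@le_trans _ _ `|(m`!)%:R * \det (mxsub f g (A *m B))|).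
    by rewrite normrM ler_peMl // ger0_norm ?ler1n ?fact_gt0.
  rewrite minor_mul; apply: le_trans (ler_norm_sum _ _ _) _.
  by apply: ler_sum => h _; rewrite normrM.
rewrite big_distrl /=; apply: ler_sum => f _.
rewrite exchange_big /= big_distrl /=; apply: ler_sum => h _.
rewrite -big_distrr /=; apply: ler_wpM2l => //.
rewrite [leRHS](bigD1 h) //= lerDl.
by apply: sumr_ge0 => h' _; apply: sumr_ge0.
Qed.

End SingularValues.

(** * Sums over words *)
Section Words.

Lemma sum_tuple_cons (V : nmodType) (I : finType) (k : nat) (F : seq I -> V) :
  \sum_(w : k.+1.-tuple I) F w = \sum_i \sum_(w : k.-tuple I) F (i :: w).
Proof.
rewrite pair_big /=.
rewrite (reindex (fun p : I * k.-tuple I => [tuple of p.1 :: p.2])) //=.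
exists (fun w : k.+1.-tuple I => (thead w, [tuple of behead w])) => [[i w]|w] _.
  by rewrite theadE; congr (_, _); apply: val_inj.
by rewrite /= -tuple_eta.
Qed.

Lemma sum_tuple_nil (V : nmodType) (I : finType) (F : seq I -> V) :
  \sum_(w : 0.-tuple I) F w = F [::].
Proof.
rewrite (big_pred1 [tuple]) // => w.
by rewrite [w]tuple0 /= eqxx.
Qed.

Lemma sum_words_prod (R : comPzSemiRingType) (I : finType) (k : nat) (F : I -> R) :
  \sum_(w : k.-tuple I) \prod_(i <- w) F i = (\sum_i F i) ^+ k.
Proof.
elim: k => [|k IH].
  by rewrite (sum_tuple_nil (fun w => \prod_(i <- w) F i)) big_nil.
rewrite (sum_tuple_cons k (fun w => \prod_(i <- w) F i)) exprS -IH big_distrl /=.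
apply: eq_bigr => i _; rewrite big_distrr; apply: eq_bigr => w _.
by rewrite big_cons.
Qed.

End Words.

(** * Growth of triangular recursions; powers of sums *)
Section TriangularRecursion.
Variable R : realType.

(** With the weights [e ^+ r x], [e] small, the entries of [G] above the
    diagonal are multiplied by at least one factor [e], so that the weighted
    row sums are at most [kappa]; then [Z k x <= C * kappa ^+ k * e ^+ r x]
    follows by induction on [k]. *)
Lemma triangular_recursion_bound (X : finType) (r : X -> nat)
    (G : X -> X -> R) (Z : nat -> X -> R) (rho kappa : R) :
  0 <= rho -> rho < kappa ->
  (forall x y, 0 <= G x y) ->
  (forall x y, G x y != 0 -> x = y \/ (r x < r y)%N) ->
  (forall x, G x x <= rho) ->
  (forall k x, 0 <= Z k x) ->
  (forall k x, Z k.+1 x <= \sum_y G x y * Z k y) ->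
  exists2 C, 0 < C & forall k x, Z k x <= C * kappa ^+ k.
Proof.
move=> rho0 rk G0 Gtri Gdiag Z0 Zrec.
have k0 : 0 < kappa by apply: le_lt_trans rk.
pose Gt := 1 + \sum_x \sum_y G x y.
have Gt0 : 0 < Gt.
  by rewrite ltr_wpDr // sumr_ge0 // => x _; apply: sumr_ge0.
(* Any [e] with [rho + e * Gt <= kappa] would do; the minimum with [1] ensures
   that larger ranks have smaller weights. *)
pose e := Num.min 1 ((kappa - rho) / Gt).
have e0 : 0 < e by rewrite lt_min ltr01 divr_gt0 // subr_gt0.
have e1 : e <= 1 by rewrite ge_min lexx.
have eG : rho + e * Gt <= kappa.
  by rewrite addrC -lerBrDr -ler_pdivlMr // ge_min lexx orbT.
pose C := 1 + \sum_x Z 0 x / e ^+ r x.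
have C_gt0 : 0 < C.
  rewrite ltr_wpDr // sumr_ge0 // => x _.
  by rewrite divr_ge0 // exprn_ge0 // ltW.
have key k x : Z k x <= C * kappa ^+ k * e ^+ r x.
  elim: k x => [|k IH] x.
    rewrite mulr1 -ler_pdivrMr ?exprn_gt0 // /C (bigD1 x) //= addrCA lerDl.
    rewrite addr_ge0 // sumr_ge0 // => y _.
    by rewrite divr_ge0 // exprn_ge0 // ltW.
  apply: le_trans (Zrec k x) _.
  have [K KE] : exists K, K = C * kappa ^+ k by exists (C * kappa ^+ k).
  have K0 : 0 <= K by rewrite KE mulr_ge0 ?exprn_ge0 ?ltW.
  rewrite -KE in IH.
  apply: (@le_trans _ _ (\sum_y G x y * (K * e ^+ r y))).
    by apply: ler_sum => y _; apply: ler_wpM2l.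
  apply: (@le_trans _ _ (K * e ^+ r x * (rho + e * Gt))); last first.
    have -> : C * kappa ^+ k.+1 * e ^+ r x = K * e ^+ r x * kappa.
      by rewrite KE exprSr mulrA mulrAC.
    rewrite ler_wpM2l //.
    by rewrite mulr_ge0 // exprn_ge0 // ltW.
  have Ke0 : 0 <= K * e ^+ r x by rewrite mulr_ge0 // exprn_ge0 // ltW.
  rewrite (bigD1 x) //= mulrDr; apply: lerD.
    by rewrite mulrC; apply: ler_wpM2l.
  apply: (@le_trans _ _ (\sum_(y | y != x) K * e ^+ r x * (e * G x y))).
    apply: ler_sum => y yx; have [->|Gxy] := eqVneq (G x y) 0.
      by rewrite mul0r !mulr0.
    have [xy|rxy] := Gtri _ _ Gxy; first by rewrite xy eqxx in yx.
    rewrite mulrC -!mulrA ler_wpM2l // [leRHS]mulrA ler_wpM2r //.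
    by rewrite -exprSr ler_wiXn2l // ltW.
  rewrite -big_distrr -big_distrr /=; apply: ler_wpM2l => //.
  apply: ler_wpM2l; first exact: ltW.
  have le1 : \sum_(y | y != x) G x y <= \sum_y G x y.
    by rewrite [leRHS](bigD1 x) //= lerDr.
  have le2 : \sum_y G x y <= \sum_z \sum_y G z y.
    rewrite [leRHS](bigD1 x) //= lerDl.
    by apply: sumr_ge0 => z _; apply: sumr_ge0.
  by rewrite /Gt (le_trans le1) // (le_trans le2) // lerDr.
exists C => // k x; apply: le_trans (key k x) _.
have Ck0 : 0 <= C * kappa ^+ k by rewrite mulr_ge0 ?exprn_ge0 ?ltW.
by rewrite ler_piMr // exprn_ile1 // ltW.
Qed.

(** The concave function [z `^ a] lies above its chord on [[0, x + y]]:
    [z `^ a >= (x + y) `^ a * (z / (x + y))] for [z] equal to [x] or [y]. *)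
Lemma ler_powRD (a x y : R) : 0 < a <= 1 -> 0 <= x -> 0 <= y ->
  (x + y) `^ a <= x `^ a + y `^ a.
Proof.
move=> /andP[a0 a1] x0 y0.
have [t0|t0] := eqVneq (x + y) 0.
  by rewrite t0 powR0 ?gt_eqF // addr_ge0 ?powR_ge0.
have {}t0 : 0 < x + y by rewrite lt_def t0 addr_ge0.
have ge1 z : 0 <= z -> z <= x + y -> (x + y) `^ a * (z / (x + y)) <= z `^ a.
  move=> z0 zt.
  have {2}-> : z = (x + y) * (z / (x + y)) by rewrite mulrCA divff ?gt_eqF ?mulr1.
  have q0 : 0 <= z / (x + y) by rewrite divr_ge0 // ltW.
  rewrite powRM ?(ltW t0) // ler_wpM2l ?powR_ge0 //.
  move: q0; rewrite le_eqVlt => /predU1P[<-|q0]; first exact: powR_ge0.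
  by apply: ger1_powR => //; rewrite q0 ler_pdivrMr // mul1r.
apply: le_trans (lerD (ge1 x x0 _) (ge1 y y0 _)); rewrite ?lerDl ?lerDr //.
by rewrite -mulrDr -mulrDl divff ?gt_eqF // mulr1.
Qed.

Lemma ler_powR_sum (J : Type) (s : seq J) (P : pred J) (F : J -> R) (a : R) :
  0 < a <= 1 -> (forall j, 0 <= F j) ->
  (\sum_(j <- s | P j) F j) `^ a <= \sum_(j <- s | P j) F j `^ a.
Proof.
move=> a01 F0; elim: s => [|j s IH].
  by rewrite !big_nil powR0 // gt_eqF //; case/andP: a01.
rewrite !big_cons; case: ifP => // _.
apply: le_trans (ler_powRD a01 (F0 j) (sumr_ge0 _ _)) _ => //.
by rewrite lerD2l.
Qed.

Lemma powR_prod (J : Type) (s : seq J) (P : pred J) (F : J -> R) (a : R) :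
  (forall j, 0 <= F j) ->
  (\prod_(j <- s | P j) F j) `^ a = \prod_(j <- s | P j) F j `^ a.
Proof.
move=> F0; elim: s => [|j s IH]; first by rewrite !big_nil powR1.
rewrite !big_cons; case: ifP => // _.
by rewrite powRM ?IH // prodr_ge0.
Qed.

End TriangularRecursion.

(** * Minors of products of triangular matrices *)
Section TriangularMinors.
Variables (R : realDomainType) (n : nat) (rk : 'I_n -> nat).

(** A rank function on the indices covers both kinds of triangular matrices at
    once: the rank is the index itself or decreases with it. *)
Definition triangular_for (M : 'M[R]_n) :=
  forall a b, M a b != 0 -> a = b \/ (rk a < rk b)%N.

Lemma triangular_forM (M N : 'M[R]_n) :
  triangular_for M -> triangular_for N -> triangular_for (M *m N).
Proof.
move=> Mt Nt a b; rewrite mxE => /eqP; apply: contra_notP => /not_orP[ab rab].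
apply: big1 => c _; apply/eqP; rewrite mulf_eq0; apply/negPn/negP.
rewrite negb_or => /andP[/Mt ac /Nt cb].
case: ac cb => [ac|ac] [cb|cb].
- by apply: ab; rewrite ac.
- by apply: rab; rewrite ac.
- by apply: rab; rewrite -cb.
- by apply: rab; apply: ltn_trans ac cb.
Qed.

Lemma triangular_for_mul_diag (M N : 'M[R]_n) a :
  triangular_for M -> triangular_for N -> (M *m N) a a = M a a * N a a.
Proof.
move=> Mt Nt; rewrite mxE (bigD1 a) //= big1 ?addr0 // => c ca.
apply/eqP; rewrite mulf_eq0; apply/negPn/negP.
rewrite negb_or => /andP[/Mt ac /Nt cb].
case: ac ca cb => [<-|ac]; first by rewrite eqxx.
move=> ca [ca'|]; first by rewrite ca' eqxx in ca.
by move=> /(ltn_trans ac); rewrite ltnn.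
Qed.

Lemma triangular_for1 : triangular_for 1%:M.
Proof.
move=> a b; rewrite mxE; have [ab|_] := eqVneq a b; first by left.
by rewrite eqxx.
Qed.

(** Index maps are ordered by this sum: a nonzero product of entries of a
    triangular matrix leads from [f] to [f] itself or to a larger sum. *)
Definition rank_sum (m : nat) (f : {ffun 'I_m -> 'I_n}) : nat :=
  (\sum_j rk (f j))%N.

Definition entry_prod (m : nat) (M : 'M[R]_n) (f g : {ffun 'I_m -> 'I_n}) : R :=
  \prod_j `|M (f j) (g j)|.

Lemma entry_prod_ge0 (m : nat) (M : 'M[R]_n) (f g : {ffun 'I_m -> 'I_n}) :
  0 <= entry_prod M f g.
Proof. by apply: prodr_ge0. Qed.

(** A nonzero product has all its factors nonzero, so every rank weakly
    increases from [f] to [g], and some rank strictly if [f] and [g] differ. *)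
Lemma entry_prod_triangular (m : nat) (M : 'M[R]_n) (f g : {ffun 'I_m -> 'I_n}) :
  triangular_for M -> entry_prod M f g != 0 ->
  f = g \/ (rank_sum f < rank_sum g)%N.
Proof.
move=> Mt /prodf_neq0 fg.
have le_fg j : (rk (f j) <= rk (g j))%N.
  by have := fg j isT; rewrite normr_eq0 => /Mt[->//|/ltnW].
have [/eqP|] := boolP (f == g); first by left.
move=> fgN; right.
have [j fgj] : exists j, f j != g j.
  apply/existsP; apply: contraNT fgN; rewrite negb_exists => /forallP h.
  by apply/eqP/ffunP => j; apply/eqP; have := h j; rewrite negbK.
rewrite /rank_sum (bigD1 j) //= [X in (_ < X)%N](bigD1 j) //= -addSn.
apply: leq_add; last by apply: leq_sum.
have := fg j isT; rewrite normr_eq0 => /Mt[ab|//].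
by rewrite ab eqxx in fgj.
Qed.

(** In the Leibniz expansion, the term of a permutation [s] is controlled by
    the entries from [f] to [f \o s], which have the same rank sum; so only
    the identity contributes. *)
Lemma minor_triangular (m : nat) (M : 'M[R]_n) (f : {ffun 'I_m -> 'I_n}) :
  triangular_for M -> injectiveb f ->
  \det (mxsub f f M) = \prod_j M (f j) (f j).
Proof.
move=> Mt /injectiveP f_inj; rewrite /determinant (bigD1 1%g) //= odd_perm1 mul1r.
rewrite [X in _ + X]big1 ?addr0 => [|s s1].
  by apply: eq_bigr => j _; rewrite !mxE perm1.
apply/eqP; rewrite mulf_eq0 signr_eq0 /=; apply/negPn/negP.
move=> p0; pose g := [ffun j => f (s j)] : {ffun 'I_m -> 'I_n}.
have : entry_prod M f g != 0.
  rewrite /entry_prod -normr_prod normr_eq0; apply: contraNneq p0 => p0; apply/eqP.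
  by rewrite -[RHS]p0; apply: eq_bigr => j _; rewrite !mxE ffunE.
case/(entry_prod_triangular Mt) => [fg|].
  case/negP: s1; apply/eqP/permP => j; rewrite perm1; apply: f_inj.
  by rewrite [in RHS]fg ffunE.
rewrite /rank_sum; under [X in (_ < X)%N]eq_bigr do rewrite ffunE.
by rewrite [X in (X < _)%N](reindex_inj (@perm_inj _ s)) ltnn.
Qed.

Variables (I : Type) (T : I -> 'M[R]_n).
Hypothesis T_tri : forall i, triangular_for (T i).

Lemma word_mx_cons i w : word_mx T (i :: w) = T i *m word_mx T w.
Proof. by rewrite /word_mx big_cons. Qed.

Lemma word_mx_triangular w : triangular_for (word_mx T w).
Proof.
elim: w => [|i w IH]; first by rewrite /word_mx big_nil; apply: triangular_for1.
by rewrite word_mx_cons; apply: triangular_forM.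
Qed.

Lemma word_mx_diag w a : word_mx T w a a = \prod_(i <- w) T i a a.
Proof.
elim: w => [|i w IH]; first by rewrite /word_mx !big_nil mxE eqxx.
rewrite word_mx_cons triangular_for_mul_diag //; last exact: word_mx_triangular.
by rewrite big_cons IH.
Qed.

Lemma minor_word_diag (m : nat) (f : {ffun 'I_m -> 'I_n}) w : injectiveb f ->
  `|\det (mxsub f f (word_mx T w))| = \prod_(i <- w) entry_prod (T i) f f.
Proof.
move=> f_inj; rewrite minor_triangular //; last exact: word_mx_triangular.
rewrite normr_prod exchange_big /=; apply: eq_bigr => j _.
by rewrite word_mx_diag normr_prod.
Qed.

(** Summing over the columns [g], which the expansion of a product along its
    first factor does not touch, leaves a recursion in the rows [f] alone. *)
Definition row_minors (m : nat) (w : seq I) (f : {ffun 'I_m -> 'I_n}) : R :=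
  \sum_(g : {ffun 'I_m -> 'I_n}) `|\det (mxsub f g (word_mx T w))|.

Lemma row_minors_ge0 m w (f : {ffun 'I_m -> 'I_n}) : 0 <= row_minors w f.
Proof. exact: sumr_ge0. Qed.

(** Only injective [h] matter, as the other minors vanish. This is what limits
    the diagonal coefficients to products of distinct diagonal entries. *)
Lemma row_minors_cons m i w (f : {ffun 'I_m -> 'I_n}) :
  row_minors (i :: w) f <=
  \sum_(h : {ffun 'I_m -> 'I_n} | injectiveb h) entry_prod (T i) f h * row_minors w h.
Proof.
apply: (@le_trans _ _ (\sum_(g : {ffun 'I_m -> 'I_n})
   \sum_(h : {ffun 'I_m -> 'I_n} | injectiveb h)
   entry_prod (T i) f h * `|\det (mxsub h g (word_mx T w))|)); last first.
  by rewrite exchange_big /=; apply: ler_sum => h _; rewrite big_distrr.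
apply: ler_sum => g _; rewrite word_mx_cons minor_mul_expand.
apply: le_trans (ler_norm_sum _ _ _) _.
rewrite (bigID (fun h : {ffun 'I_m -> 'I_n} => injectiveb h)) /=.
rewrite [X in _ + X]big1 ?addr0 => [|h /minor_noninj->]; last by rewrite mulr0 normr0.
by apply: ler_sum => h _; rewrite normrM normr_prod.
Qed.

End TriangularMinors.

(** * Growth of the sums over words of a given length *)
Section WordSums.
Variables (R : realType) (n : nat) (rk : 'I_n -> nat).
Variables (I : finType) (T : I -> 'M[R]_n).
Hypothesis T_tri : forall i, triangular_for rk (T i).
Variables (m m' : nat) (a b : R).
Hypothesis a01 : 0 < a <= 1.
Hypothesis b01 : 0 < b <= 1.

Local Notation fn k := {ffun 'I_k -> 'I_n}.

(** For [f] and [g] injective these are the competing exponential growth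
    rates of [word_sum]. *)
Definition diag_sum (f : fn m) (g : fn m') : R :=
  \sum_i entry_prod (T i) f f `^ a * entry_prod (T i) g g `^ b.

Definition word_sum (k : nat) : R :=
  \sum_(w : k.-tuple I)
    minor_norm m (word_mx T w) `^ a * minor_norm m' (word_mx T w) `^ b.

(** The norms are bounded below by the single diagonal minors at [f] and [g],
    which are multiplicative along words. *)
Lemma word_sum_ge (f : fn m) (g : fn m') (k : nat) :
  injectiveb f -> injectiveb g -> diag_sum f g ^+ k <= word_sum k.
Proof.
move=> f_inj g_inj; rewrite /diag_sum -sum_words_prod; apply: ler_sum => w _.
have le_norm p (h : fn p) : injectiveb h ->
    \prod_(i <- w) entry_prod (T i) h h <= minor_norm p (word_mx T w).
  move=> h_inj; rewrite -(minor_word_diag T_tri) // /minor_norm.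
  rewrite (bigD1 h) //= (bigD1 h) //= -addrA lerDl addr_ge0 ?sumr_ge0 // => h' _.
  exact: sumr_ge0.
case/andP: a01 b01 => a0 _ /andP[b0 _].
rewrite big_split /= -!powR_prod; do ?by move=> i; apply: entry_prod_ge0.
have D0 p (h : fn p) : 0 <= \prod_(i <- w) entry_prod (T i) h h.
  by apply: prodr_ge0 => i _; apply: entry_prod_ge0.
apply: ler_pM; [exact: powR_ge0|exact: powR_ge0| |];
by rewrite ge0_ler_powR ?nnegrE ?minor_norm_ge0 ?D0 ?le_norm ?(ltW a0) ?(ltW b0).
Qed.

(** Raising the recursion of the minors to the powers [a] and [b], by
    subadditivity, and summing over the words gives a recursion indexed by
    pairs of maps whose diagonal coefficients are the [diag_sum f g]. *)
Lemma word_sum_le (rho kappa : R) : 0 <= rho -> rho < kappa ->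
  (forall (f : fn m) (g : fn m'), injectiveb f -> injectiveb g ->
     diag_sum f g <= rho) ->
  exists2 C, 0 < C & forall k, word_sum k <= C * kappa ^+ k.
Proof.
move=> rho0 rk_lt Frho.
case/andP: (a01) (b01) => a0 a1 /andP[b0 b1].
pose X := ({ffun 'I_m -> 'I_n} * {ffun 'I_m' -> 'I_n})%type.
pose G (x y : X) : R := if injectiveb y.1 && injectiveb y.2 then
  \sum_i entry_prod (T i) x.1 y.1 `^ a * entry_prod (T i) x.2 y.2 `^ b else 0.
pose Z k (x : X) : R := \sum_(w : k.-tuple I)
  row_minors T w x.1 `^ a * row_minors T w x.2 `^ b.
have G0 x y : 0 <= G x y.
  rewrite /G; case: ifP => // _; apply: sumr_ge0 => i _.
  by rewrite mulr_ge0 ?powR_ge0.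
have Z0 k x : 0 <= Z k x.
  by apply: sumr_ge0 => w _; rewrite mulr_ge0 ?powR_ge0.
have powR_neq0 (x c : R) : 0 < c -> x `^ c != 0 -> x != 0.
  by move=> c0; apply: contraNneq => ->; rewrite powR0 ?eqxx ?gt_eqF.
have Gtri x y : G x y != 0 -> x = y \/
    (rank_sum rk x.1 + rank_sum rk x.2 < rank_sum rk y.1 + rank_sum rk y.2)%N.
  case: x y => [x1 x2] [y1 y2]; rewrite /G /=; case: ifP => [_|]; last by rewrite eqxx.
  rewrite psumr_neq0 => [/hasP[i _ /= Gi]|i _]; last by rewrite mulr_ge0 ?powR_ge0.
  have {Gi} : entry_prod (T i) x1 y1 `^ a * entry_prod (T i) x2 y2 `^ b != 0.
    by rewrite gt_eqF.
  rewrite mulf_eq0 negb_or => /andP[/(powR_neq0 _ _ a0) G1 /(powR_neq0 _ _ b0) G2].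
  have [->|r1] := entry_prod_triangular (@T_tri i) G1;
  have [->|r2] := entry_prod_triangular (@T_tri i) G2; first by left.
  - by right; rewrite ltn_add2l.
  - by right; rewrite ltn_add2r.
  by right; rewrite -addSn leq_add // ltnW.
have Gdiag x : G x x <= rho.
  by rewrite /G; case: ifP => // /andP[]; apply: Frho.
have Zrec k x : Z k.+1 x <= \sum_y G x y * Z k y.
  case: x => x1 x2.
  rewrite /Z (sum_tuple_cons k (fun w => row_minors T w x1 `^ a * row_minors T w x2 `^ b)) /=.
  have step p (h : fn p) (c : R) i w : 0 < c <= 1 ->
      row_minors T (i :: w) h `^ c <= \sum_(h' : fn p | injectiveb h')
        entry_prod (T i) h h' `^ c * row_minors T w h' `^ c.
    move=> /[dup] c01 /andP[c0 _].
    have rm0 u (h' : fn p) : 0 <= row_minors T u h' := row_minors_ge0 T u h'.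
    have em0 (h' : fn p) : 0 <= entry_prod (T i) h h' := entry_prod_ge0 _ _ _.
    apply: (@le_trans _ _ ((\sum_(h' : fn p | injectiveb h')
        entry_prod (T i) h h' * row_minors T w h') `^ c)).
      rewrite ge0_ler_powR ?nnegrE ?row_minors_cons ?(ltW c0) //.
      by apply: sumr_ge0 => h' _; rewrite mulr_ge0.
    apply: le_trans (ler_powR_sum _ _ c01 _) _; first by move=> h'; rewrite mulr_ge0.
    by apply: ler_sum => h' _; rewrite powRM.
  apply: (@le_trans _ _ (\sum_i \sum_(w : k.-tuple I) \sum_(y : X | injectiveb y.1 && injectiveb y.2)
     (entry_prod (T i) x1 y.1 `^ a * entry_prod (T i) x2 y.2 `^ b) *
     (row_minors T w y.1 `^ a * row_minors T w y.2 `^ b))).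
    apply: ler_sum => i _; apply: ler_sum => w _.
    apply: le_trans (ler_pM (powR_ge0 _ _) (powR_ge0 _ _) (step _ _ _ _ _ a01) (step _ _ _ _ _ b01)) _.
    rewrite big_distrl /=; under eq_bigr do rewrite big_distrr /=.
    rewrite pair_big /=; apply: ler_sum => -[y1 y2] _ /=.
    by rewrite mulrACA.
  rewrite (eq_bigr (fun i => \sum_(y : X | injectiveb y.1 && injectiveb y.2)
     (entry_prod (T i) x1 y.1 `^ a * entry_prod (T i) x2 y.2 `^ b) * Z k y)) => [|i _]; last first.
    by rewrite exchange_big /=; apply: eq_bigr => y _; rewrite -big_distrr.
  rewrite exchange_big /= big_mkcond /=; apply: ler_sum => y _; rewrite /G /=.
  by case: ifP => _; rewrite ?mul0r // big_distrl.
have [C C0 CP] := triangular_recursion_bound rho0 rk_lt G0 Gtri Gdiag Z0 Zrec.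
have k0 : 0 < kappa by apply: le_lt_trans rk_lt.
exists (C * (1 + #|{: X}|%:R)) => [|k]; first by rewrite mulr_gt0 // ltr_wpDr.
apply: (@le_trans _ _ (\sum_(x : X) Z k x)).
  rewrite /word_sum /Z exchange_big /=; apply: ler_sum => w _.
  apply: (@le_trans _ _ ((\sum_(f : fn m) row_minors T w f `^ a) *
                         (\sum_(g : fn m') row_minors T w g `^ b))).
    by apply: ler_pM; rewrite ?powR_ge0 //; apply: ler_powR_sum => // h;
       apply: row_minors_ge0.
  rewrite big_distrl /=; under eq_bigr do rewrite big_distrr /=.
  by rewrite pair_big.
apply: (@le_trans _ _ (\sum_(x : X) C * kappa ^+ k)); first exact: ler_sum.
have Ck : 0 <= C * kappa ^+ k by rewrite mulr_ge0 ?exprn_ge0 ?(ltW C0) ?(ltW k0).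
by rewrite sumr_const -[leLHS]mulr_natr [leRHS]mulrAC ler_wpM2l // lerDr.
Qed.

End WordSums.

(** * Exponential growth rates *)
Section GrowthRate.
Variable R : realType.

(** Constant factors disappear after taking logarithms and dividing by [k], so
    the limit is at least [ln rho] and at most [ln kappa] for each
    [kappa > rho]. *)
Lemma growth_rate_cvg (S : nat -> R) (rho c : R) : 0 < rho -> 0 < c ->
  (forall k, c * rho ^+ k <= S k) ->
  (forall kappa, rho < kappa -> exists2 C, 0 < C &
     forall k, S k <= C * kappa ^+ k) ->
  k%:R^-1 * ln (S k) @[k --> \oo] --> ln rho.
Proof.
move=> rho0 c0 Sge Sle; apply/cvgrPdist_le => e e0.
pose kappa := rho * expR (e / 2).
(* Half of the error [e] is spent on [ln kappa - ln rho], the other half on the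
   constants. *)
have [|C C0 CP] := Sle kappa.
  by rewrite /kappa ltr_pMr // -expR0 ltr_expR divr_gt0.
have kappa0 : 0 < kappa by rewrite mulr_gt0 // expR_gt0.
have ln_kappa : ln kappa = ln rho + e / 2.
  by rewrite /kappa lnM ?posrE ?expR_gt0 // expRK.
have lnX (x y : R) k : 0 < x -> 0 < y -> ln (x * y ^+ k) = ln x + k%:R * ln y.
  by move=> x0 y0; rewrite lnM ?posrE ?exprn_gt0 // lnXn // mulr_natl.
near=> k.
have k0 : 0 < k%:R :> R by near: k; apply: nbhs_infty_gtr.
have kbig : 2 * (`|ln c| + `|ln C|) / e < k%:R by near: k; apply: nbhs_infty_gtr.
have S0 : 0 < S k by apply: lt_le_trans (Sge k); rewrite mulr_gt0 ?exprn_gt0.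
have lo : ln c + k%:R * ln rho <= ln (S k).
  by rewrite -lnX // ler_ln ?posrE ?mulr_gt0 ?exprn_gt0.
have hi : ln (S k) <= ln C + k%:R * (ln rho + e / 2).
  by rewrite -ln_kappa -lnX // ler_ln ?posrE ?mulr_gt0 ?exprn_gt0.
rewrite ltr_pdivrMr // in kbig.
have c1 : - `|ln c| <= ln c by rewrite lerNl -normrN ler_norm.
have C1 := ler_norm (ln C); have c2 := normr_ge0 (ln c); have C2 := normr_ge0 (ln C).
have -> : ln rho - k%:R^-1 * ln (S k) = k%:R^-1 * (k%:R * ln rho - ln (S k)).
  by rewrite mulrBr mulKf // gt_eqF.
rewrite normrM gtr0_norm ?invr_gt0 // mulrC ler_pdivrMr // ler_norml.
by apply/andP; split; nra.
Unshelve. all: by end_near.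
Qed.

End GrowthRate.

(** * Comparison of the singular value function with minors *)
Section Comparison.
Variables (R : realType) (n : nat).

Lemma sv_functionE (s : R) (m : nat) (M : 'M[R]_n) : M \in unitmx ->
  (m < n)%N -> m%:R <= s < m.+1%:R ->
  sv_function s M =
    top_product m M `^ (m.+1%:R - s) * top_product m.+1 M `^ (s - m%:R).
Proof.
move=> uM mn ms; have tE : Num.truncn s = m by apply: truncn_def.
have [_ _ pos _] := singular_valuesP uM.
have topS : top_product m.+1 M = top_product m M * singular_value M m.
  by rewrite /top_product big_ord_recr.
have top0 := top_product_gt0 uM (ltnW mn).
rewrite /sv_function tE topS powRM ?(ltW top0) ?(ltW (pos m mn)) // mulrA; congr (_ * _).
have ab : m.+1%:R - s + (s - m%:R) = 1 by rewrite -natr1; ring.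
by rewrite -powRD ab ?powRr1 ?(ltW top0) // oner_eq0.
Qed.

Lemma word_mx_conj (I : Type) (A : I -> 'M[R]_n) (P : 'M[R]_n) w :
  P \in unitmx ->
  word_mx (fun i => invmx P *m A i *m P) w = invmx P *m word_mx A w *m P.
Proof.
move=> uP; elim: w => [|i w IH].
  by rewrite /word_mx !big_nil mulmx1 mulVmx.
by rewrite !word_mx_cons IH !mulmxA mulmxK.
Qed.

Lemma word_mx_unit (I : Type) (A : I -> 'M[R]_n) w :
  (forall i, A i \in unitmx) -> word_mx A w \in unitmx.
Proof.
move=> uA; elim: w => [|i w IH]; first by rewrite /word_mx big_nil unitmx1.
by rewrite word_mx_cons unitmx_mul uA.
Qed.

(** By submultiplicativity of [minor_norm], conjugation by [P] changes it by at
    most the factor [minor_norm m P * minor_norm m (invmx P)]. *)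
Lemma top_product_conj (m : nat) (P : 'M[R]_n) : (m <= n)%N -> P \in unitmx ->
  exists2 K : R, 0 < K & forall M : 'M[R]_n, M \in unitmx ->
    top_product m M <= K * minor_norm m (invmx P *m M *m P) /\
    minor_norm m (invmx P *m M *m P) <= K * top_product m M.
Proof.
move=> mn uP; have [C C0 CP] := minor_norm_le_top_product R mn.
pose K := 1 + minor_norm m P * minor_norm m (invmx P).
have NP0 := minor_norm_ge0 m P; have NV0 := minor_norm_ge0 m (invmx P).
have K0 : 0 < K by rewrite ltr_wpDr // mulr_ge0.
have KC0 : 0 < K * (1 + C) by rewrite mulr_gt0 // addr_gt0.
have mul3 (X Y Z : 'M[R]_n) : minor_norm m (X *m Y *m Z) <=
    minor_norm m X * minor_norm m Z * minor_norm m Y.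
  apply: le_trans (minor_norm_mul _ _ _) _.
  rewrite mulrAC ler_wpM2r ?minor_norm_ge0 //; exact: minor_norm_mul.
exists (K * (1 + C)) => // M uM.
have N0 := minor_norm_ge0 m M; have top0 := ltW (top_product_gt0 uM mn).
have N0' := minor_norm_ge0 m (invmx P *m M *m P).
split.
  apply: le_trans (top_product_le_minor_norm uM mn) _.
  have := mul3 P (invmx P *m M *m P) (invmx P).
  rewrite !mulmxA (mulmxV uP) mul1mx mulmxK // => /le_trans; apply.
  apply: ler_wpM2r => //; apply: (@le_trans _ _ K); first by rewrite /K lerDr.
  by rewrite ler_peMr ?(ltW K0) // lerDl ltW.
apply: le_trans (mul3 _ _ _) _; rewrite mulrC.
apply: (@le_trans _ _ (C * top_product m M * K)).
  by apply: ler_pM; rewrite ?mulr_ge0 ?CP // mulrC /K lerDr.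
by rewrite mulrAC ler_wpM2r // mulrC ler_wpM2l ?(ltW K0) // lerDr.
Qed.

End Comparison.

(** * The pressure as a maximum *)
Section Pressure.
Variables (R : realType) (n : nat) (rk : 'I_n -> nat).
Variables (I : finType) (A : I -> 'M[R]_n) (P : 'M[R]_n).
Hypothesis I_gt0 : (0 < #|I|)%N.
Hypothesis A_unit : forall i, A i \in unitmx.
Hypothesis P_unit : P \in unitmx.
Let T i := invmx P *m A i *m P.
Hypothesis T_tri : forall i, triangular_for rk (T i).

(** The determinant of a triangular matrix is its minor at the identity map,
    so a nonsingular one has no zero on the diagonal. *)
Lemma entry_prod_diag_gt0 (m : nat) i (f : {ffun 'I_m -> 'I_n}) :
  0 < entry_prod (T i) f f.
Proof.
apply: prodr_gt0 => j _; rewrite normr_gt0.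
have : \det (T i) != 0.
  by rewrite -unitfE -unitmxE !unitmx_mul unitmx_inv P_unit A_unit.
pose id_f : {ffun 'I_n -> 'I_n} := [ffun i => i].
have id_inj : injectiveb id_f by apply/injectiveP => x y; rewrite !ffunE.
have -> : T i = mxsub id_f id_f (T i) by apply/matrixP => x y; rewrite !mxE !ffunE.
rewrite (minor_triangular (@T_tri i) id_inj) => /prodf_neq0/(_ (f j) isT).
by rewrite ffunE [in X in _ -> X]mxE !ffunE.
Qed.

(** By [sv_functionE] and [top_product_conj], the sums defining the pressure
    are within constant factors of the sums [word_sum] for the triangular
    matrices, whose growth rate is the largest [diag_sum]. *)
Lemma pressure_eq_max (m : nat) (s : R) : (m < n)%N -> m%:R < s < m.+1%:R ->
  exists (f : {ffun 'I_m -> 'I_n}) (g : {ffun 'I_m.+1 -> 'I_n}),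
    [/\ injectiveb f, injectiveb g,
        (forall (f' : {ffun 'I_m -> 'I_n}) (g' : {ffun 'I_m.+1 -> 'I_n}),
          injectiveb f' -> injectiveb g' ->
          diag_sum T (m.+1%:R - s) (s - m%:R) f' g' <=
          diag_sum T (m.+1%:R - s) (s - m%:R) f g) &
        pressure A s = ln (diag_sum T (m.+1%:R - s) (s - m%:R) f g)].
Proof.
move=> mn /andP[ms sm]; set a := m.+1%:R - s; set b := s - m%:R.
have ab : a + b = 1 by rewrite /a /b -natr1; ring.
have a0 : 0 < a by rewrite subr_gt0.
have b0 : 0 < b by rewrite subr_gt0.
have a01 : 0 < a <= 1 by rewrite a0 -ab lerDl ltW.
have b01 : 0 < b <= 1 by rewrite b0 -ab lerDr ltW.
pose X := ({ffun 'I_m -> 'I_n} * {ffun 'I_m.+1 -> 'I_n})%type.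
pose p0 : X := ([ffun i => widen_ord (ltnW mn) i], [ffun i => widen_ord mn i]).
pose Q (p : X) := injectiveb p.1 && injectiveb p.2.
have Qp0 : Q p0.
  by apply/andP; split; apply/injectiveP => x y; rewrite !ffunE => /(congr1 val) /= /val_inj.
pose F (p : X) := diag_sum T a b p.1 p.2.
case: (arg_maxP F Qp0) => -[f g] /andP[/= f_inj g_inj] Fmax.
exists f, g; split=> // [f' g' f'_inj g'_inj|].
  by apply: (Fmax (f', g')); rewrite /Q f'_inj.
have sn : s < n%:R by apply: lt_le_trans sm _; rewrite ler_nat.
rewrite /pressure sn; apply/cvg_lim => //.
have [K K0 KP] := top_product_conj (ltnW mn) P_unit.
have [K' K'0 K'P] := top_product_conj mn P_unit.
have rho0 : 0 < diag_sum T a b f g.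
  have [i0 _] := card_gt0P I_gt0.
  rewrite /diag_sum (bigD1 i0) //= ltr_pwDl ?mulr_gt0 ?powR_gt0 ?entry_prod_diag_gt0 //.
  by apply: sumr_ge0 => i _; rewrite mulr_ge0 ?powR_ge0.
have comp k : (K `^ a * K' `^ b)^-1 * word_sum T m m.+1 a b k <=
    \sum_(w : k.-tuple I) sv_function s (word_mx A w) <=
    K `^ a * K' `^ b * word_sum T m m.+1 a b k.
  have KK0 : 0 < K `^ a * K' `^ b by rewrite mulr_gt0 ?powR_gt0.
  rewrite mulrC ler_pdivrMr // [X in _ <= X * _ ]/= /word_sum.
  rewrite [in X in X && _]mulrC !big_distrr /=.
  apply/andP; split; apply: ler_sum => w _;
  have uw : word_mx A w \in unitmx by [exact: word_mx_unit];
  rewrite (sv_functionE uw mn) ?(ltW ms) // -/a -/b word_mx_conj //;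
  have [h1 h2] := KP _ uw; have [h3 h4] := K'P _ uw;
  have t0 := ltW (top_product_gt0 uw (ltnW mn));
  have t0' := ltW (top_product_gt0 uw mn);
  have N0 := minor_norm_ge0 m (invmx P *m word_mx A w *m P);
  have N0' := minor_norm_ge0 m.+1 (invmx P *m word_mx A w *m P);
  rewrite mulrACA -!powRM ?(ltW K0) ?(ltW K'0) //;
  apply: ler_pM; rewrite ?powR_ge0 // ge0_ler_powR ?nnegrE ?(ltW a0) ?(ltW b0) //;
  by rewrite mulr_ge0 // ltW.
apply: (@growth_rate_cvg _ _ _ (K `^ a * K' `^ b)^-1) => //.
- by rewrite invr_gt0 mulr_gt0 ?powR_gt0.
- move=> k; have /andP[+ _] := comp k; apply: le_trans.
  rewrite ler_wpM2l ?invr_ge0 ?mulr_ge0 ?powR_ge0 //.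
  exact: word_sum_ge.
move=> kappa kP.
have diag_le (f' : {ffun 'I_m -> 'I_n}) (g' : {ffun 'I_m.+1 -> 'I_n}) :
    injectiveb f' -> injectiveb g' -> diag_sum T a b f' g' <= diag_sum T a b f g.
  by move=> f'_inj g'_inj; apply: (Fmax (f', g')); rewrite /Q f'_inj.
have [C C0 CP] := word_sum_le (@T_tri) a01 b01 (ltW rho0) kP diag_le.
exists (K `^ a * K' `^ b * C); first by rewrite !mulr_gt0 ?powR_gt0.
move=> k; have /andP[_ +] := comp k; move/le_trans; apply.
by rewrite -[leRHS]mulrA ler_wpM2l // mulr_ge0 ?powR_ge0.
Qed.

End Pressure.

(** * Counting zeros by Rolle's theorem *)
Section RolleFinite.
Variable R : realType.

Lemma is_derive_continuous (f df : R -> R) :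
  (forall x : R, is_derive x (1 : R) f (df x)) -> continuous f.
Proof.
move=> fd x; apply/differentiable_continuous/derivable1_diffP.
by have [] := fd x.
Qed.

(** Between two consecutive zeros of [f] there is one of [df]; along an
    increasing sequence these are again increasing. *)
Lemma rolle_zeros (f df : R -> R) (x : R) (s : seq R) :
  (forall x : R, is_derive x (1 : R) f (df x)) ->
  path <%R x s -> f x = 0 -> {in s, forall y, f y = 0} ->
  exists t : seq R, [/\ size t = size s, path <%R x t & {in t, forall y, df y = 0}].
Proof.
move=> fd; elim: s x => [|y s IH] x /= xs fx fs; first by exists [::].
case/andP: xs => xy ys.
have fy : f y = 0 by apply: fs; rewrite mem_head.
have [|t [szt yt dft]] := IH y ys fy.
  by move=> z zs; apply: fs; rewrite inE zs orbT.
have [|||c cxy dfc] := @Rolle R f x y xy.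
- by move=> z _; have [] := fd z.
- exact/continuous_subspaceT/is_derive_continuous.
- by rewrite fx fy.
move: cxy; rewrite in_itv /= => /andP[xc cy].
exists (c :: t); split; rewrite /= ?szt // ?xc /=.
  case: t yt {szt dft} => //= z t /andP[yz ->].
  by rewrite (lt_trans cy yz).
move=> z; rewrite inE => /predU1P[->|/dft//].
by have [_ <-] := fd c; have [_ ->] := dfc.
Qed.

Lemma finite_zeros (f df : R -> R) : (forall x : R, is_derive x (1 : R) f (df x)) ->
  finite_set [set x | df x = 0] -> finite_set [set x | f x = 0].
Proof.
move=> fd /finite_seqP[Z ZE]; apply: contrapT => /(@infinite_set_fset _ _ (size Z).+2).
case=> B Bf szB; pose s := sort <=%R (enum_fset B).
have s_lt : sorted <%R s by rewrite sort_lt_sorted fset_uniq.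
have fs : {in s, forall x, f x = 0} by move=> x; rewrite mem_sort => /Bf.
have szs : ((size Z).+2 <= size s)%N by rewrite size_sort.
case: s s_lt fs szs => // x s /= xs fs szs.
have [||t [szt xt dft]] := rolle_zeros fd xs.
- by apply: fs; rewrite mem_head.
- by move=> y ys; apply: fs; rewrite inE ys orbT.
have uniq_t : uniq t.
  by apply: (sorted_uniq lt_trans lt_irreflexive); apply: path_sorted xt.
have /(uniq_leq_size uniq_t) : {subset t <= Z}.
  by move=> y /dft dfy; have : [set x | df x = 0] y by []; rewrite ZE.
by rewrite szt; apply/negP; rewrite -ltnNge.
Qed.

End RolleFinite.

(** * Exponential sums *)
Section ExpSums.
Variable R : realType.

Definition exp_sum (s : seq (R * R)) (x : R) : R :=
  \sum_(p <- s) p.1 * expR (p.2 * x).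

Lemma exp_sum_cat (s t : seq (R * R)) x : exp_sum (s ++ t) x = exp_sum s x + exp_sum t x.
Proof. by rewrite /exp_sum big_cat. Qed.

Lemma is_derive_exp_sum (s : seq (R * R)) (x : R) :
  is_derive x (1 : R) (exp_sum s) (exp_sum [seq (p.1 * p.2, p.2) | p <- s] x).
Proof.
elim: s => [|[c b] s IH].
  have -> : exp_sum [::] = cst 0 by apply/funext => y; rewrite /exp_sum big_nil.
  exact: is_derive_cst.
have -> : exp_sum ((c, b) :: s) = (fun y => c * expR (b * y)) + exp_sum s.
  by apply/funext => y; rewrite /exp_sum big_cons.
rewrite /exp_sum /= big_cons -/(exp_sum _ x); apply: is_deriveD.
have -> : (fun y : R => c * expR (b * y)) = c *: (expR \o ( *%R b)) by [].
rewrite -mulrA [b * expR _]mulrC; apply: is_deriveZ.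
have lin : is_derive x (1 : R) ( *%R b) b.
  have := @is_deriveZ _ _ _ (@id R) b x 1 1 (is_derive_id _ _).
  by rewrite /GRing.scale /= mulr1.
exact: is_derive1_comp.
Qed.

(** Induction on the number of terms. Dividing by the first exponential turns
    its term into a constant, which differentiation removes; Rolle's theorem
    goes back from the derivative, which has one term less, to the sum. *)
Lemma exp_sum_zeros (s : seq (R * R)) :
  (forall x, exp_sum s x = 0) \/ finite_set [set x | exp_sum s x = 0].
Proof.
have [k] := ubnP (size s); elim: k s => // k IH [|[c b] s] /=.
  by left=> x; rewrite /exp_sum big_nil.
rewrite ltnS => szs.
pose s1 := [seq (p.1, p.2 - b) | p <- s].
pose g x := c + exp_sum s1 x.
have gE x : exp_sum ((c, b) :: s) x = expR (b * x) * g x.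
  rewrite /exp_sum big_cons /g /exp_sum big_map mulrDr mulrC; congr (_ + _).
  rewrite big_distrr /=; apply: eq_bigr => p _.
  by rewrite mulrCA -expRD; congr (_ * expR _); ring.
have zeroE : [set x | exp_sum ((c, b) :: s) x = 0] = [set x | g x = 0].
  apply/seteqP; split=> x /=; rewrite gE; last by move=> ->; rewrite mulr0.
  by move/eqP; rewrite mulf_eq0 gt_eqF ?expR_gt0 //= => /eqP.
have gd x : is_derive x (1 : R) g (exp_sum [seq (p.1 * p.2, p.2) | p <- s1] x).
  have -> : g = cst c + exp_sum s1 by [].
  rewrite -[X in is_derive _ _ _ X]add0r; apply: is_deriveD.
  exact: is_derive_exp_sum.
rewrite zeroE; have [|dg0|dgfin] := IH [seq (p.1 * p.2, p.2) | p <- s1].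
- by rewrite !size_map.
- have gcst x : g x = g 0.
    by apply: is_derive_0_is_cst => y; rewrite -(dg0 y).
  have [g0|g0] := eqVneq (g 0) 0.
    by left=> x; rewrite gE gcst g0 mulr0.
  right; rewrite (_ : [set x | g x = 0] = set0) //.
  by apply/seteqP; split=> x //=; rewrite gcst => /eqP; rewrite (negPf g0).
by right; apply: finite_zeros gd dgfin.
Qed.

End ExpSums.

(** * Power series with geometrically bounded coefficients *)
Section PowerSeries.
Variable R : realType.
Implicit Types (a b : nat -> R) (h q r M : R).

(** Bounds of this form amount to a positive radius of convergence; they are
    used because they are stable under all the operations needed here, with
    explicit constants. *)
Definition geo_bounded a M q := forall k, `|a k| <= M * q ^+ k.

Lemma geo_bounded_ge0 a M q : geo_bounded a M q -> 0 <= M.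
Proof. by move=> /(_ 0%N); rewrite mulr1; apply: le_trans. Qed.

Lemma geo_bounded_cvg a M q h : 0 <= q -> geo_bounded a M q -> q * `|h| < 1 ->
  cvgn (pseries a h).
Proof.
move=> q0 aM qh; have M0 := geo_bounded_ge0 aM; apply: normed_cvg.
apply: (series_le_cvg (v_ := geometric M (q * `|h|))) => //=.
- by move=> k; rewrite !mulr_ge0 // exprn_ge0 // mulr_ge0.
- by move=> k; rewrite normrM normrX exprMn mulrA ler_wpM2r ?exprn_ge0.
by apply: is_cvg_geometric_series; rewrite ger0_norm // mulr_ge0.
Qed.

(** The factor [k + 1] of differentiation is absorbed by [2 ^+ k.+1]. *)
Lemma geo_bounded_diffs a M q : 0 <= q -> geo_bounded a M q ->
  geo_bounded (pseries_diffs a) (2 * q * M) (2 * q).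
Proof.
move=> q0 aM k; have M0 := geo_bounded_ge0 aM.
rewrite /pseries_diffs normrM normr_nat.
have -> : 2 * q * M * (2 * q) ^+ k = 2 ^+ k.+1 * (M * q ^+ k.+1).
  by rewrite exprMn !exprS; ring.
apply: ler_pM => //; rewrite -natrX ler_nat; exact: ltnW (ltn_expl _ _).
Qed.

(** The coefficients of the second derivative are bounded with the ratio
    [4 * q], and their series has to converge at [r] as well. *)
Lemma pseries_is_derive a M q r h : 0 <= q -> geo_bounded a M q ->
  4 * q * r < 1 -> `|h| < r ->
  is_derive h (1 : R) (fun y => limn (pseries a y)) (limn (pseries (pseries_diffs a) h)).
Proof.
move=> q0 aM qr hr.
have r0 : 0 < r by apply: le_lt_trans hr.
have ad := geo_bounded_diffs q0 aM.
have q20 : 0 <= 2 * q by rewrite mulr_ge0.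
have add := geo_bounded_diffs q20 ad.
have q40 : 0 <= 2 * (2 * q) by rewrite mulr_ge0.
apply: (@pseries_snd_diffs _ a r); last by rewrite (gtr0_norm r0).
- by apply: (geo_bounded_cvg q0 aM); rewrite (gtr0_norm r0); nra.
- by apply: (geo_bounded_cvg q20 ad); rewrite (gtr0_norm r0); nra.
- by apply: (geo_bounded_cvg q40 add); rewrite (gtr0_norm r0); nra.
Qed.

Lemma cvg_geo_bounded a h : 0 < h -> cvgn (pseries a h) ->
  exists2 M, 0 < M & geo_bounded a M h^-1.
Proof.
move=> h0 /cvg_series_bounded [M0 [_ MP]].
pose M := `|M0| + 1.
exists M => [|k]; first by rewrite ltr_wpDl.
rewrite exprVn ler_pdivlMr ?exprn_gt0 //.
have : `|a k * h ^+ k| <= M.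
  by apply: (MP M) => //; rewrite /M ltr_pwDr // ler_norm.
by rewrite normrM (gtr0_norm (exprn_gt0 _ h0)).
Qed.

Definition cauchy_product a b (k : nat) : R := \sum_(j < k.+1) a (k - j)%N * b j.

Lemma geometric_half_le (p N : nat) : (p <= N)%N ->
  \sum_(p <= i < N) (2^-1 : R) ^+ i <= 2 * 2^-1 ^+ p.
Proof.
move=> pN; suff -> : \sum_(p <= i < N) (2^-1 : R) ^+ i = 2 * 2^-1 ^+ p - 2 * 2^-1 ^+ N.
  by rewrite gerBl mulr_ge0 // exprn_ge0.
elim: N pN => [|N IH]; first by rewrite leqn0 => /eqP ->; rewrite big_geq // subrr.
rewrite leq_eqVlt => /predU1P[->|]; first by rewrite big_geq // subrr.
rewrite ltnS => pN; rewrite big_nat_recr //= IH // exprS; lra.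
Qed.

(** A partial sum of the product series is a sum over a triangle, taken here
    column by column. *)
Lemma series_cauchy_product (u v : nat -> R) (N : nat) :
  \sum_(0 <= k < N) cauchy_product u v k =
  \sum_(0 <= j < N) v j * \sum_(0 <= i < N - j) u i.
Proof.
elim: N => [|N IH]; first by rewrite !big_nil.
rewrite big_nat_recr //= IH [RHS]big_nat_recr //= subSnn big_nat1.
rewrite /cauchy_product big_ord_recr /= subnn addrA [u 0%N * _]mulrC; congr (_ + _).
rewrite big_mkord [in RHS]big_mkord -big_split /=; apply: eq_bigr => j _.
by rewrite subSn ?(ltnW (ltn_ord j)) // big_nat_recr //= mulrDr [u _ * _]mulrC.
Qed.

(** The product of two partial sums differs from the partial sum of the
    product series by [\sum_j v_j * \sum_(N - j <= i < N) u_i]. With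
    [q * `|h| <= 4^-1], bounding [u_i] by [2^-i] but [v_j] by [4^-j] makes this
    at most a constant times [2^-N]. *)
Lemma cauchy_product_cvg a b M M' q h : 0 <= q ->
  geo_bounded a M q -> geo_bounded b M' q -> q * `|h| <= 4^-1 ->
  pseries (cauchy_product a b) h @ \oo -->
    limn (pseries a h) * limn (pseries b h).
Proof.
move=> q0 aM bM qh.
have M0 := geo_bounded_ge0 aM; have M'0 := geo_bounded_ge0 bM.
have qh1 : q * `|h| < 1 by apply: le_lt_trans qh _; lra.
have ca := geo_bounded_cvg q0 aM qh1; have cb := geo_bounded_cvg q0 bM qh1.
pose u i := a i * h ^+ i; pose v i := b i * h ^+ i.
have ule i : `|u i| <= M * 2^-1 ^+ i.
  rewrite /u normrM normrX; apply: le_trans (ler_wpM2r _ (aM i)) _; first exact: exprn_ge0.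
  rewrite -mulrA -exprMn ler_wpM2l // lerXn2r ?nnegrE ?mulr_ge0 //.
  by apply: le_trans qh _; lra.
have vle i : `|v i| <= M' * (2^-1 * 2^-1) ^+ i.
  rewrite /v normrM normrX; apply: le_trans (ler_wpM2r _ (bM i)) _; first exact: exprn_ge0.
  rewrite -mulrA -exprMn ler_wpM2l // lerXn2r ?nnegrE ?mulr_ge0 //.
  by apply: le_trans qh _; lra.
have convE k : cauchy_product a b k * h ^+ k = cauchy_product u v k.
  rewrite /cauchy_product big_distrl /=; apply: eq_bigr => j _.
  by rewrite /u /v mulrACA -exprD subnK // -ltnS.
have psE : pseries (cauchy_product a b) h = fun N => \sum_(0 <= k < N) cauchy_product u v k.
  by apply/funext => N; apply: eq_bigr => k _; apply: convE.
have prod_cvg : (pseries a h \* pseries b h) @ \oo -->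
    limn (pseries a h) * limn (pseries b h).
  exact: cvgM ca cb.
rewrite psE.
suff dcvg : (fun N => (pseries a h \* pseries b h) N -
     \sum_(0 <= k < N) cauchy_product u v k) @ \oo --> (0 : R).
  have -> : (fun N => \sum_(0 <= k < N) cauchy_product u v k) =
      (pseries a h \* pseries b h) - (fun N => (pseries a h \* pseries b h) N -
        \sum_(0 <= k < N) cauchy_product u v k).
    by apply/funext => N; rewrite [RHS]/= !fctE /= opprB addrC subrK.
  rewrite -[X in _ --> X]subr0; exact: cvgB.
have dE N : (pseries a h \* pseries b h) N - \sum_(0 <= k < N) cauchy_product u v k =
    \sum_(0 <= j < N) v j * \sum_(N - j <= i < N) u i.
  rewrite series_cauchy_product /= mulrC.
  rewrite -/(series u) -/(series v) /= big_distrl /= -sumrB.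
  apply: eq_bigr => j _; rewrite -mulrBr; congr (_ * _).
  by apply/eqP; rewrite subr_eq addrC -big_cat_nat ?leq_subr.
have dle N : `|(pseries a h \* pseries b h) N - \sum_(0 <= k < N) cauchy_product u v k| <=
    4 * M * M' * 2^-1 ^+ N.
  rewrite dE; apply: le_trans (ler_norm_sum _ _ _) _.
  apply: (@le_trans _ _ (\sum_(0 <= j < N) 2 * M * M' * 2^-1 ^+ N * 2^-1 ^+ j)).
    rewrite !big_mkord; apply: ler_sum => j _; rewrite normrM.
    have jN := ltnW (ltn_ord j).
    apply: (@le_trans _ _ (M' * (2^-1 * 2^-1) ^+ j * (M * (2 * 2^-1 ^+ (N - j))))).
      apply: ler_pM => //; apply: le_trans (ler_norm_sum _ _ _) _.
      apply: (@le_trans _ _ (\sum_(N - j <= i < N) M * 2^-1 ^+ i)); first exact: ler_sum.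
      by rewrite -big_distrr ler_wpM2l // geometric_half_le // leq_subr.
    rewrite -[X in _ <= _ * _ ^+ X * _](subnK jN) exprD exprMn.
    by rewrite le_eqVlt; apply/orP; left; apply/eqP; ring.
  rewrite -big_distrr /=.
  have := geometric_half_le (leq0n N); rewrite expr0 mulr1 => half.
  have C0 : 0 <= 2 * M * M' * 2^-1 ^+ N by rewrite !mulr_ge0 // exprn_ge0.
  by apply: le_trans (ler_wpM2l C0 half) _; rewrite le_eqVlt; apply/orP; left; apply/eqP; ring.
apply/norm_cvg0P.
apply: (@squeeze_cvgr _ _ _ _ (cst 0) (fun N => 4 * M * M' * 2^-1 ^+ N)).
- by near=> N; rewrite normr_ge0 dle.
- exact: cvg_cst.
rewrite -[X in _ --> X](mulr0 (4 * M * M')); apply: cvgM; first exact: cvg_cst.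
by apply: cvg_expr; rewrite ger0_norm //; lra.
Unshelve. all: by end_near.
Qed.

End PowerSeries.

(** * Logarithms of analytic functions *)
Section LogAnalytic.
Variable R : realType.

Lemma locally_constant (F : R -> R) (r : R) :
  (forall h : R, `|h| < r -> is_derive h (1 : R) F 0) ->
  forall h, `|h| < r -> F h = F 0.
Proof.
move=> dF h hr.
have seg (u v : R) : u <= v -> (forall z, u <= z <= v -> `|z| < r) -> F v = F u.
  move=> uv zr; apply/eqP; rewrite -subr_eq0.
  have [||c _ ->] := @MVT_segment R F (fun=> 0) u v uv; last by rewrite mul0r.
  - move=> z; rewrite in_itv /= => /andP[uz zv].
    by apply: dF; apply: zr; rewrite !ltW.
  apply: derivable_within_continuous => z; rewrite in_itv /= => /zr/dF.
  by case.
have [h0|h0] := leP 0 h.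
  apply: seg => // z /andP[z0 zh]; rewrite ger0_norm //.
  by apply: le_lt_trans zh _; rewrite -(ger0_norm h0).
apply/esym; apply: seg; first exact: ltW.
move=> z /andP[hz z0]; rewrite ler0_norm //; apply: le_lt_trans hr.
by rewrite (ltr0_norm h0) lerN2.
Qed.

Lemma pseries_at0 (a : nat -> R) : pseries a 0 @ \oo --> a 0%N.
Proof.
apply: cvg_near_cst; near=> N.
have N0 : (0 < N)%N by near: N; exists 1%N.
rewrite -(prednK N0); rewrite /pseries /series /= big_nat_recl // expr0 mulr1.
by rewrite big1 ?addr0 // => i _; rewrite expr0n mulr0.
Unshelve. all: by end_near.
Qed.

(** Solving for the coefficients of [b] one after the other. *)
Lemma power_series_quotient (F : fieldType) (a c : nat -> F) : a 0%N != 0 ->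
  exists b : nat -> F, forall k, \sum_(j < k.+1) a (k - j)%N * b j = c k.
Proof.
move=> a0.
(* [B k] agrees with the solution on the indices below [k]. *)
pose fix B (k : nat) : nat -> F := if k is k'.+1 then
   fun j => if (j < k')%N then B k' j else
     (c k' - \sum_(i < k') a (k' - i)%N * B k' i) / a 0%N
  else fun=> 0.
pose b j := B j.+1 j.
have Bb k j : (j < k)%N -> B k j = b j.
  elim: k j => // k IH j; rewrite ltnS leq_eqVlt => /predU1P[->//|jk].
  by rewrite /= jk IH.
exists b => k; rewrite big_ord_recr /= subnn.
rewrite [in X in _ + X]/b /= ltnn mulrCA divff // mulr1 addrC.
rewrite (eq_bigr (fun i : 'I_k => a (k - i)%N * b i)) ?subrK // => i _.
by rewrite Bb.
Qed.

(** Inductively, [a_0 * `|b k|] is at most [a_0 * q ^+ k.+1] times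
    [1 + \sum_(j < k) 2 ^+ j = 2 ^+ k]. *)
Lemma quotient_geo_bounded (a b c : nat -> R) (q : R) : 0 <= q -> 0 < a 0%N ->
  geo_bounded a (a 0%N) q -> geo_bounded c (a 0%N * q) q ->
  (forall k, cauchy_product a b k = c k) -> geo_bounded b q (2 * q).
Proof.
move=> q0 a0 aM cM abc k; have [n] := ubnP k; elim: n k => // n IH k kn.
rewrite -(ler_pM2l a0).
have bE : a 0%N * b k = c k - \sum_(j < k) a (k - j)%N * b j.
  by rewrite -abc /cauchy_product big_ord_recr /= subnn [X in X - _]addrC addrK.
have -> : a 0%N * `|b k| = `|a 0%N * b k| by rewrite normrM (gtr0_norm a0).
have K0 : 0 <= a 0%N * q * q ^+ k by rewrite !mulr_ge0 ?exprn_ge0 // ltW.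
have terms (j : 'I_k) : `|a (k - j)%N * b j| <= a 0%N * q * q ^+ k * 2 ^+ j.
  have jk := ltnW (ltn_ord j).
  have bj : `|b j| <= q * (2 * q) ^+ j by apply: IH; apply: leq_trans (ltn_ord j) kn.
  rewrite normrM; apply: le_trans (ler_pM _ _ (aM _) bj) _ => //.
  have -> : q ^+ k = q ^+ (k - j) * q ^+ j by rewrite -exprD subnK.
  by rewrite exprMn le_eqVlt; apply/orP; left; apply/eqP; ring.
have sum2 : \sum_(j < k) 2 ^+ j = 2 ^+ k - 1 :> R.
  elim: (k) => [|m IHm]; first by rewrite big_ord0 subrr.
  by rewrite big_ord_recr /= IHm exprS; ring.
rewrite bE; apply: le_trans (ler_normB _ _) _.
apply: (@le_trans _ _ (a 0%N * q * q ^+ k + a 0%N * q * q ^+ k * (2 ^+ k - 1))).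
  apply: lerD; first exact: cM.
  apply: le_trans (ler_norm_sum _ _ _) _; rewrite -sum2 big_distrr /=.
  exact: ler_sum.
by rewrite exprMn le_eqVlt; apply/orP; left; apply/eqP; ring.
Qed.

(** The coefficients of [f' / f] are obtained by division of power series and
    have geometric bounds. Integrating them term by term gives a power series
    [G] with [G' = f' / f] near [x] and the same value as [ln \o f] at [x], so
    [G = ln \o f]. *)
Lemma real_analytic_at_ln (f : R -> R) (x : R) :
  real_analytic_at f x -> 0 < f x -> real_analytic_at (fun y => ln (f y)) x.
Proof.
case=> a /nbhs_ballP[d /= d0 dP] fx0.
have af h : `|h| < d -> pseries a h @ \oo --> f (x + h).
  move=> hd; have := dP (x + h); rewrite /= addrAC subrr add0r; apply.
  by rewrite /ball /= opprD addNKr normrN.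
have a0E : a 0%N = f x.
  have := af 0; rewrite normr0 addr0 => /(_ d0) a0.
  exact: (cvg_unique _ (@pseries_at0 a) a0).
have a0 : 0 < a 0%N by rewrite a0E.
pose h0 := d / 2.
have h0_gt0 : 0 < h0 by rewrite divr_gt0.
have [M M0 aM] : exists2 M, 0 < M & geo_bounded a M h0^-1.
  apply: cvg_geo_bounded => //; apply: cvgP; apply: af.
  by rewrite gtr0_norm // /h0; lra.
pose t := 1 + M / a 0%N.
have t1 : 1 <= t by rewrite lerDl divr_ge0 // ltW.
have Mt : M <= a 0%N * t by rewrite /t mulrDr mulrCA divff ?gt_eqF // !mulr1 lerDr ltW.
(* Up to [a_0], the power [t ^+ k] absorbs the constant [M] for [k >= 1], and
   [2 ^+ k] absorbs the factor [k] of the derivative series. *)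
pose q := 2 * t / h0.
have q0 : 0 < q by rewrite divr_gt0 // mulr_gt0 // (lt_le_trans ltr01).
have ka k : (0 < k)%N -> k%:R * `|a k| <= a 0%N * q ^+ k.
  move=> k0; rewrite /q !exprMn.
  apply: (@le_trans _ _ (2 ^+ k * (a 0%N * t ^+ k * h0^-1 ^+ k))); last first.
    by rewrite le_eqVlt; apply/orP; left; apply/eqP; ring.
  apply: ler_pM => //; first by rewrite -natrX ler_nat ltnW // ltn_expl.
  apply: le_trans (aM k) _; rewrite ler_wpM2r ?exprn_ge0 ?invr_ge0 ?(ltW h0_gt0) //.
  apply: le_trans Mt _; rewrite ler_wpM2l ?(ltW a0) //.
  by apply: ler_eXnr.
have aq : geo_bounded a (a 0%N) q.
  case=> [|k]; first by rewrite mulr1 gtr0_norm.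
  by apply: le_trans (ka k.+1 _); rewrite // ler_peMl // ler1n.
have dq : geo_bounded (pseries_diffs a) (a 0%N * q) q.
  move=> k; rewrite /pseries_diffs normrM normr_nat -mulrA -exprS.
  exact: ka.
have [b bE] := power_series_quotient (pseries_diffs a) (lt0r_neq0 a0).
have bq := quotient_geo_bounded (ltW q0) a0 aq dq bE.
(* The series of [c] is the antiderivative of that of [b] with the value
   [ln (f x)] at the origin. *)
pose c k := if k is k'.+1 then b k' / k'.+1%:R else ln (a 0%N).
have cq : geo_bounded c (1 + `|ln (a 0%N)|) (2 * q).
  case=> [|k]; rewrite /c; first by rewrite mulr1 lerDr.
  rewrite normrM normfV normr_nat ler_pdivrMr ?ltr0n //.
  apply: le_trans (bq k) _.
  have p0 : 0 <= (2 * q) ^+ k by rewrite exprn_ge0 // mulr_ge0 // ltW.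
  have n0 := normr_ge0 (ln (a 0%N)).
  apply: (@le_trans _ _ ((1 + `|ln (a 0%N)|) * (2 * q) ^+ k.+1)); last first.
    by rewrite ler_peMr ?ler1n // mulr_ge0 ?addr_ge0 // exprn_ge0 // mulr_ge0 // (ltW q0).
  by rewrite [in leRHS]exprS [leRHS]mulrA ler_wpM2r //; nra.
have dc : pseries_diffs c = b.
  by apply/funext => k; rewrite /pseries_diffs /c mulrCA divff ?mulr1 // pnatr_eq0.
have Q0 : 0 <= 2 * q by rewrite mulr_ge0 // ltW.
have aQ : geo_bounded a (a 0%N) (2 * q).
  move=> k; apply: le_trans (aq k) _; rewrite ler_wpM2l ?(ltW a0) //.
  rewrite lerXn2r ?nnegrE ?(ltW q0) //; lra.
pose F h := limn (pseries a h); pose G h := limn (pseries c h).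
have FE h : `|h| < d -> F h = f (x + h).
  by move=> /af fh; apply/cvg_lim.
have F0 : F 0 = a 0%N by rewrite FE ?normr0 // addr0 a0E.
(* Inside this radius the three bounds [4 * (2 * q) * r0 < 1],
   [2 * q * r0 <= 4^-1] and [2 * q * r0 < 1] required below all hold. *)
pose r0 := (5 * (2 * q))^-1.
have r00 : 0 < r0 by rewrite invr_gt0 mulr_gt0 // mulr_gt0.
have qr0 : (2 * q) * r0 = 5^-1.
  by rewrite /r0 invfM mulrCA divff ?mulr1 // gt_eqF // mulr_gt0.
have Fd h : `|h| < r0 -> is_derive h (1 : R) F (limn (pseries (pseries_diffs a) h)).
  by move=> hr; apply: (pseries_is_derive Q0 aQ _ hr); rewrite -mulrA qr0; lra.
have Gd h : `|h| < r0 -> is_derive h (1 : R) G (limn (pseries b h)).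
  move=> hr; rewrite -dc.
  by apply: (pseries_is_derive Q0 cq _ hr); rewrite -mulrA qr0; lra.
have FGE h : `|h| < r0 -> F h * limn (pseries b h) = limn (pseries (pseries_diffs a) h).
  move=> hr; apply/esym/cvg_lim => //.
  have -> : pseries_diffs a = cauchy_product a b by apply/funext => k; rewrite /cauchy_product bE.
  apply: (cauchy_product_cvg Q0 aQ bq).
  have : 2 * q * `|h| <= 2 * q * r0 by rewrite ler_wpM2l // ltW.
  by rewrite qr0; lra.
have Fpos : \forall h \near (0 : R), 0 < F h.
  have : {for 0, continuous F}.
    apply/differentiable_continuous/derivable1_diffP.
    by have [] := Fd 0 _; rewrite ?normr0.
  by move=> /cvgr_gt; apply; rewrite F0.
case/nbhs_ballP: Fpos => r1 /= r10 Fpos.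
pose r := Num.min d (Num.min r0 r1).
have r_gt0 : 0 < r by rewrite !lt_min d0 r00 r10.
have lnFG h : `|h| < r -> ln (F h) = G h.
  move=> hr; apply/eqP; rewrite -subr_eq0; apply/eqP.
  have D z : `|z| < r -> is_derive z (1 : R) ((@ln R \o F) - G) 0.
    rewrite !lt_min => /and3P[_ zr0 zr1].
    have Fz : 0 < F z by apply: Fpos; rewrite /ball /= sub0r normrN.
    have <- : (F z)^-1 * limn (pseries (pseries_diffs a) z) - limn (pseries b z) = 0.
      by rewrite -FGE // mulKf ?subrr // gt_eqF.
    apply: is_deriveB; last exact: Gd.
    apply: is_derive1_comp; [exact: is_derive1_ln|exact: Fd].
  have := locally_constant D hr; rewrite !fctE /= => ->.
  rewrite F0 (_ : G 0 = c 0%N) ?subrr //.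
  by apply/cvg_lim => //; apply: pseries_at0.
exists c; apply/nbhs_ballP; exists r => //= y; rewrite /ball /= distrC => yr.
have := yr; rewrite !lt_min => /and3P[yd yr0 _].
have -> : f y = F (y - x) by rewrite FE // addrC subrK.
rewrite lnFG //; apply: (geo_bounded_cvg Q0 cq).
have : 2 * q * `|y - x| <= 2 * q * r0 by rewrite ler_wpM2l // ltW.
by rewrite qr0; lra.
Qed.

Lemma real_analytic_at_exp_sum (s : seq (R * R)) (x : R) :
  real_analytic_at (exp_sum s) x.
Proof.
exists (fun k => \sum_(p <- s) p.1 * expR (p.2 * x) * (k`!%:R^-1 * p.2 ^+ k)).
near=> y; set h := y - x.
have -> : exp_sum s y = \sum_(p <- s) p.1 * expR (p.2 * x) * expR (p.2 * h).
  apply: eq_bigr => p _; rewrite -mulrA -expRD /h; congr (_ * expR _); ring.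
have -> : pseries (fun k => \sum_(p <- s) p.1 * expR (p.2 * x) * (k`!%:R^-1 * p.2 ^+ k)) h =
    \sum_(p <- s) (fun N => p.1 * expR (p.2 * x) * series (exp_coeff (p.2 * h)) N).
  apply/funext => N; rewrite /pseries /series /=.
  rewrite fct_sumE; under eq_bigr do rewrite big_distrl /=.
  rewrite exchange_big /=; apply: eq_bigr => p _; rewrite big_distrr /=.
  by apply: eq_bigr => k _; rewrite /exp_coeff /= exprMn; ring.
elim: s => [|p s IH]; first by rewrite !big_nil; apply: cvg_cst.
rewrite !big_cons; apply: cvgD => //.
apply: cvgM; first exact: cvg_cst.
exact: is_cvg_series_exp_coeff.
Unshelve. all: by end_near.
Qed.

End LogAnalytic.

(** * Piecewise analyticity *)
Section Piecewise.
Variable R : realType.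

Lemma next_point_right (s : seq R) (x e : R) : 0 < e ->
  exists2 m, x < m <= x + e & forall z, z \in s -> x < z -> m <= z.
Proof.
move=> e0; elim: s => [|a s [m /andP[xm me] mP]].
  by exists (x + e) => //; rewrite ltrDl e0 lexx.
have [xa|ax] := ltP x a; last first.
  exists m; rewrite ?xm // => z; rewrite inE => /predU1P[->|/mP//].
  by rewrite ltNge ax.
exists (Num.min a m); first by rewrite lt_min xa xm ge_min me orbT.
move=> z; rewrite inE ge_min => /predU1P[->|zs xz]; first by rewrite lexx.
by rewrite (mP _ zs xz) orbT.
Qed.

Lemma open_before_next (s : seq R) (c : R) :
  open [set y | forall z, z \in s -> c < z -> y < z].
Proof.
elim: s => [|a t IH].
  by rewrite (_ : mkset _ = setT); [exact: openT | apply/seteqP; split].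
rewrite (_ : mkset _ = [set y | c < a -> y < a] `&`
   [set y | forall z, z \in t -> c < z -> y < z]); last first.
  apply/seteqP; split=> y /=.
    by move=> yP; split=> [|z zt]; apply: yP; rewrite inE ?eqxx // zt orbT.
  by case=> ya yt z; rewrite inE => /predU1P[->//|]; apply: yt.
apply: openI => //; have [ca|ca] := boolP (c < a).
  rewrite (_ : mkset _ = [set y | y < a]); first exact: open_lt.
  by apply/seteqP; split=> y /=; [apply | move=> ->].
rewrite (_ : mkset _ = setT); first exact: openT.
by apply/seteqP; split=> y.
Qed.

(** The intervals are indexed by their left end points, which are [0] and the
    positive exceptional points; each extends to the next of these points, and
    the last one to infinity. Every [x >= 0] is a limit from the right of
    points of the interval that starts at the largest end point [<= x]. *)
Lemma piecewise_of_finite_exceptions (f : R -> R) (Z : seq R) :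
  (forall x, 0 < x -> x \notin Z -> real_analytic_at f x) ->
  piecewise_real_analytic `[0, +oo[ f.
Proof.
move=> fan; pose s := 0 :: [seq z <- Z | 0 < z].
have s_ge0 z : z \in s -> 0 <= z.
  by rewrite inE mem_filter => /predU1P[->|/andP[/ltW]].
pose J (k : 'I_(size s)) : set R :=
  [set y | s`_k < y /\ forall z, z \in s -> s`_k < z -> y < z].
have J_gt0 k y : J k y -> 0 < y.
  by case=> ky _; apply: le_lt_trans ky; apply: s_ge0; apply: mem_nth.
exists (size s), J; split.
- move=> k; split; last first.
    move=> x y [kx xP] [_ yP] z /andP[xz zy]; split; first exact: lt_le_trans xz.
    by move=> w ws kw; apply: le_lt_trans zy (yP w ws kw).
  apply: openI; first exact: open_gt.
  exact: open_before_next.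
- apply/seteqP; split=> x.
    rewrite /= in_itv /= andbT => x0 B /nbhs_ballP[e /= e0 eB].
    have e20 : 0 < e / 2 by rewrite divr_gt0.
    have [m /andP[xm me] mP] := next_point_right s x e20.
    have [k [kx kmax]] : exists k : 'I_(size s), s`_k <= x /\
        forall i : 'I_(size s), s`_i <= x -> s`_i <= s`_k.
      pose Q (i : 'I_(size s)) := s`_i <= x.
      have Q0 : Q ord0 by rewrite /Q.
      by case: (arg_maxP (fun i : 'I_(size s) => s`_i) Q0) => k kx kmax; exists k.
    pose y := (x + m) / 2.
    exists y; split; last by apply: eB; rewrite /ball /= distrC gtr0_norm /y; lra.
    exists k => //; split; first by rewrite /y; lra.
    move=> z zs kz; apply: (@lt_le_trans _ _ m); first by rewrite /y; lra.
    apply: mP => //; rewrite ltNge; apply/negP => zx.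
    have zi : (index z s < size s)%N by rewrite index_mem.
    have := kmax (Ordinal zi); rewrite /= nth_index // => /(_ zx).
    by rewrite leNgt kz.
  have sub : \bigcup_k J k `<=` [set y | 0 <= y] by move=> y [k _ /J_gt0 /ltW].
  have /closure_id clE := @closed_ge R 0.
  by move=> /(closureS sub); rewrite -clE /= in_itv /= andbT.
move=> k x kx; have x0 := J_gt0 _ _ kx; apply: fan => //; apply/negP => xZ.
case: kx => kx /(_ x); rewrite ltxx => /(_ _ kx); apply/not_implyP; split=> //.
by rewrite inE mem_filter x0 xZ orbT.
Qed.

Lemma real_analytic_at_near (f g : R -> R) (x : R) :
  (\forall y \near x, f y = g y) -> real_analytic_at g x -> real_analytic_at f x.
Proof.
move=> fg [a ag]; exists a; near=> y.
have -> : f y = g y by near: y.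
by near: y.
Unshelve. all: by end_near.
Qed.

(** The maximising index [p] may depend on [y]; [log_max_exp_sums_analytic]
    shows that it can be taken locally constant off a finite set. *)
Definition is_log_max_at (X : finType) (S : X -> seq (R * R)) (Q : pred X)
    (f : R -> R) (y : R) : Prop :=
  exists p, [/\ Q p, forall q, Q q -> exp_sum (S q) y <= exp_sum (S p) y &
             f y = ln (exp_sum (S p) y)].

(** Off the finitely many points where two distinct sums of the family meet,
    the sums attaining the maximum at [x] are all identical, and by continuity
    the other sums stay below them near [x]. *)
Lemma log_max_exp_sums_analytic (X : finType) (S : X -> seq (R * R)) (Q : pred X) :
  (forall p x, Q p -> 0 < exp_sum (S p) x) ->
  exists Z : seq R, forall f x, x \notin Z ->
    (\forall y \near x, is_log_max_at S Q f y) -> real_analytic_at f x.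
Proof.
move=> S0.
have diffE p q x : exp_sum (S p ++ [seq (- t.1, t.2) | t <- S q]) x =
    exp_sum (S p) x - exp_sum (S q) x.
  rewrite exp_sum_cat; congr (_ + _); rewrite /exp_sum big_map -sumrN.
  by apply: eq_bigr => t _; rewrite mulNr.
have zeros (pq : X * X) : exists Z : seq R,
    (forall x, exp_sum (S pq.1) x = exp_sum (S pq.2) x) \/
    forall x, exp_sum (S pq.1) x = exp_sum (S pq.2) x -> x \in Z.
  case: pq => p q /=.
  have [eq0|/finite_seqP[Z ZE]] := exp_sum_zeros (S p ++ [seq (- t.1, t.2) | t <- S q]).
    by exists [::]; left=> x; apply/eqP; rewrite -subr_eq0 -diffE eq0.
  exists Z; right=> x pq.
  have : [set x | exp_sum (S p ++ [seq (- t.1, t.2) | t <- S q]) x = 0] x.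
    by rewrite /= diffE pq subrr.
  by rewrite ZE.
have [Z ZP] := choice zeros.
exists (flatten [seq Z pq | pq <- enum {: X * X}]) => f x xZ fmax.
have [p [Qp pmax fp]] := nbhs_singleton fmax.
have cont q : {for x, continuous (exp_sum (S q))}.
  by apply: is_derive_continuous => y; apply: is_derive_exp_sum.
pose dominates q (y : R) : Prop := Q q ->
    (forall z, exp_sum (S p) z = exp_sum (S q) z) \/ exp_sum (S q) y < exp_sum (S p) y.
have near_lt : \forall y \near x, forall q, dominates q y.
  apply: (@filter_forall _ X dominates (nbhs x) (@nbhs_filter _ x)) => q.
  have [eq_pq|neq_pq] := ZP (p, q).
    by near=> y => _; left.
  have [Qq|nQq] := boolP (Q q); last first.
    by near=> y => Qq; rewrite Qq in nQq.
  have lt_x : exp_sum (S q) x < exp_sum (S p) x.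
    rewrite lt_def pmax // andbT; apply: contra xZ => /eqP/neq_pq xZ.
    by apply/flattenP; exists (Z (p, q)) => //; apply: map_f; rewrite mem_enum.
  have : \forall y \near x, 0 < exp_sum (S p) y - exp_sum (S q) y.
    have /cvgr_gt : (fun y => exp_sum (S p) y - exp_sum (S q) y) @ x -->
        exp_sum (S p) x - exp_sum (S q) x by apply: cvgB; apply: cont.
    by apply; rewrite subr_gt0.
  by apply: filterS => y; rewrite subr_gt0 => lt_y _; right.
apply: (@real_analytic_at_near _ (fun y => ln (exp_sum (S p) y))).
  near=> y.
  have [p' [Qp' p'max ->]] : is_log_max_at S Q f y by near: y.
  congr ln; have : forall q, dominates q y by near: y.
  by case/(_ p' Qp') => [->//|]; rewrite ltNge p'max.
by apply: real_analytic_at_ln; [exact: real_analytic_at_exp_sum | exact: S0].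
Unshelve. all: by end_near.
Qed.

End Piecewise.

(** * The pressure away from finitely many points *)
Section Assembly.
Variable R : realType.

Lemma simultaneously_triangularisable_rank (n : nat) (I : Type) (A : I -> 'M[R]_n) :
  simultaneously_triangularisable A ->
  exists2 P : 'M[R]_n, P \in unitmx & exists rk : 'I_n -> nat,
    forall i, triangular_for rk (invmx P *m A i *m P).
Proof.
case=> P uP [upper|lower]; exists P => //.
  exists (@nat_of_ord n) => i a b ab; case: (ltngtP a b) => [||/val_inj]; [by right| |by left].
  move=> ba; case/eqP: ab; have /is_trig_mxP/(_ _ _ ba) := upper i.
  by rewrite mxE.
exists (fun a : 'I_n => n - a)%N => i a b ab.
case: (ltngtP a b) => [||/val_inj]; [|by right; apply: ltn_sub2l|by left].
by move=> lt_ab; case/eqP: ab; have /is_trig_mxP/(_ _ _ lt_ab) := lower i.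
Qed.

Lemma diag_sum_exp_sum (n m m' : nat) (I : finType) (T : I -> 'M[R]_n)
    (f : {ffun 'I_m -> 'I_n}) (g : {ffun 'I_m' -> 'I_n}) (c s : R) :
  (forall i, 0 < entry_prod (T i) f f) -> (forall i, 0 < entry_prod (T i) g g) ->
  diag_sum T (c + 1 - s) (s - c) f g =
  exp_sum [seq (expR ((c + 1) * ln (entry_prod (T i) f f) - c * ln (entry_prod (T i) g g)),
                ln (entry_prod (T i) g g) - ln (entry_prod (T i) f f)) | i <- enum I] s.
Proof.
move=> f0 g0; rewrite /diag_sum /exp_sum big_map big_enum /=.
apply: eq_bigr => i _; rewrite /powR !gt_eqF // -!expRD; congr expR; ring.
Qed.

Lemma pressure_analytic_right (n : nat) (I : finType) (A : I -> 'M[R]_n) (x : R) :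
  (0 < #|I|)%N -> (forall i, A i \in unitmx) -> n%:R < x ->
  real_analytic_at (pressure A) x.
Proof.
move=> I_gt0 uA nx.
pose S : seq (R * R) := [seq (1, ln `|\det (A i)| / n%:R) | i <- enum I].
have SE y : exp_sum S y = \sum_i `|\det (A i)| `^ (y / n%:R).
  rewrite /exp_sum big_map big_enum /=; apply: eq_bigr => i _.
  rewrite mul1r /powR normr_eq0 -[\det _ == 0]negbK -unitfE -unitmxE uA /=.
  by congr expR; ring.
apply: (@real_analytic_at_near _ _ (fun y => ln (exp_sum S y))).
  near=> y; rewrite /pressure SE ifF //; apply/negbTE; rewrite -leNgt ltW //.
  by near: y; apply: lt_nbhsr.
apply: real_analytic_at_ln; first exact: real_analytic_at_exp_sum.
have [i0 _] := card_gt0P I_gt0.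
rewrite SE (bigD1 i0) //= ltr_pwDl ?powR_gt0 ?normr_gt0 //.
  by rewrite -unitfE -unitmxE.
by apply: sumr_ge0 => i _; apply: powR_ge0.
Unshelve. all: by end_near.
Qed.

Lemma pressure_analytic_between (n : nat) (I : finType) (A : I -> 'M[R]_n) (m : nat) :
  (0 < #|I|)%N -> (forall i, A i \in unitmx) ->
  simultaneously_triangularisable A -> (m < n)%N ->
  exists Z : seq R, forall x, m%:R < x < m.+1%:R -> x \notin Z ->
    real_analytic_at (pressure A) x.
Proof.
move=> I_gt0 uA /simultaneously_triangularisable_rank[P uP [rk tri]] mn.
pose T i := invmx P *m A i *m P.
pose X := ({ffun 'I_m -> 'I_n} * {ffun 'I_m.+1 -> 'I_n})%type.
pose Q (p : X) := injectiveb p.1 && injectiveb p.2.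
have entry0 k i (f : {ffun 'I_k -> 'I_n}) : 0 < entry_prod (T i) f f.
  exact: (entry_prod_diag_gt0 uA uP tri).
have [S SE] : exists S : X -> seq (R * R), forall p s,
    diag_sum T (m.+1%:R - s) (s - m%:R) p.1 p.2 = exp_sum (S p) s.
  by eexists=> p s; rewrite -natr1; apply: diag_sum_exp_sum.
have [|Z ZP] := @log_max_exp_sums_analytic R X S Q.
  move=> p x _; rewrite -SE; have [i0 _] := card_gt0P I_gt0.
  rewrite /diag_sum (bigD1 i0) //= ltr_pwDl ?mulr_gt0 ?powR_gt0 //.
  by apply: sumr_ge0 => i _; rewrite mulr_ge0 ?powR_ge0.
exists Z => x /andP[mx xm] xZ; apply: ZP xZ _; near=> y.
have my : m%:R < y < m.+1%:R.
  by apply/andP; split; near: y; [exact: lt_nbhsr | exact: lt_nbhsl].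
have [f [g [f_inj g_inj fgmax pE]]] := pressure_eq_max I_gt0 uA uP tri mn my.
exists (f, g); split; [by apply/andP| |by rewrite -SE].
by move=> [f' g'] /andP[/= f'_inj g'_inj]; rewrite -!SE; apply: fgmax.
Unshelve. all: by end_near.
Qed.

End Assembly.

Theorem corollary2p5 (R : realType) (n : nat) (n_gt0 : (0 < n)%N)
    (I : finType) (I_gt0 : (0 < #|I|)%N) (A : I -> 'M[R]_n)
    (A_contracting : forall i, contracting (A i))
    (A_unit : forall i, A i \in unitmx)
    (A_triang : simultaneously_triangularisable A) :
  piecewise_real_analytic `[0, +oo[ (pressure A).
Proof.
have [Z ZP] := choice (fun m : 'I_n =>
  pressure_analytic_between I_gt0 A_unit A_triang (ltn_ord m)).
apply: (@piecewise_of_finite_exceptions _ _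
  ([seq k%:R | k <- iota 0 n.+1] ++ flatten [seq Z m | m <- enum 'I_n])).
move=> x x0; rewrite mem_cat negb_or => /andP[x_nat xZ].
have nat_neq k : (k <= n)%N -> x != k%:R.
  move=> kn; apply: contraNneq x_nat => ->; apply: map_f.
  by rewrite mem_iota.
have [nx|xn] := ltP n%:R x; first exact: pressure_analytic_right.
have {}xn : x < n%:R by rewrite lt_def xn eq_sym nat_neq.
have /andP[tx xt] := truncn_itv (ltW x0).
have tn : (Num.truncn x < n)%N by rewrite -(ltr_nat R); apply: le_lt_trans xn.
apply: (ZP (Ordinal tn)).
  by rewrite /= xt andbT lt_def nat_neq // ltnW.
apply: contra xZ => xZ; apply/flattenP; exists (Z (Ordinal tn)) => //.
by apply: map_f; rewrite mem_enum.
Qed.
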